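(* For every $D\ge D_{\min}$, the capacity-distortion function of the bistatic ISAC channel satisfies $$C(D)\ \ge\ \max_{P_{UX}}\Big\{\min\{I(U;Z)+I(X;Y\mid U,S),\ I(X;Y\mid S)\}\ \Big|\ \mathbb E\big[d\big(S,\hat s^*(U,Z)\big)\big]\le D\Big\},$$ where the maximum is over pmfs $P_{UX}$ on $\mathcal U\times\mathcal X$, the cardinality of the auxiliary random variable $U$ satisfies $|\mathcal U|\le|\mathcal X|+1$, the joint distribution of $(S,U,X,Y,Z)$ is $P_{UX}P_SP_{YZ|XS}$, and $$\hat s^*(u,z)=\arg\min_{s'\in\hat{\mathcal S}}\sum_{s\in\mathcal S}P_{S|UZ}(s|u,z)\,d(s,s')$$ (ties broken arbitrarily).
   Context: Bistatic ISAC model. $\mathcal X,\mathcal S,\mathcal Y,\mathcal Z,\hat{\mathcal S}$ are finite sets, $P_S$ is a pmf on $\mathcal S$, $P_{YZ|XS}=p(y,z|x,s)$ is a conditional pmf on $\mathcal Y\times\mathcal Z$ given $(x,s)\in\mathcal X\times\mathcal S$, and $d:\mathcal S\times\hat{\mathcal S}\to\mathbb R_+$ is a (bounded) distortion function. The state sequence $S^n$ is i.i.d. $\sim P_S$ and independent of the message; the channel is memoryless: given $(x^n,s^n)$, $(Y^n,Z^n)$ has pmf $\prod_i p(y_i,z_i|x_i,s_i)$ (no feedback). The communication receiver observes $Y^n$ and knows $S^n$ (noncausally); the sensing receiver observes only $Z^n$ (it knows the codebook but not the message). A $(2^{nR},n)$ code consists of a message set $[1:2^{nR}]=\{1,\dots,\lceil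 2^{nR}\rceil\}$, an encoder $w\mapsto x^n(w)\in\mathcal X^n$, a decoder $(y^n,s^n)\mapsto\hat w$, and a state estimator $h:\mathcal Z^n\to\hat{\mathcal S}^n$, $\hat S^n=h(Z^n)$. The message $W$ is uniform on the message set. $P_e^{(n)}=\Pr\{\hat W\ne W\}$ and $D^{(n)}=\frac1n\sum_{i=1}^n\mathbb E[d(S_i,\hat S_i)]$. A pair $(R,D)$ is achievable if there is a sequence of $(2^{nR},n)$ codes with $\lim_n P_e^{(n)}=0$ and $\limsup_n D^{(n)}\le D$. The capacity-distortion function is $C(D)=\max\{R\ge 0:(R,D)\text{ achievable}\}$. $D_{\min}$ is the minimum of $\mathbb E[d(S,\hat s(Z))]$ over all pmfs $P_X$ on $\mathcal X$ and all maps $\hat s:\mathcal Z\to\hat{\mathcal S}$, with $(X,S,Y,Z)\sim P_XP_SP_{YZ|XS}$. Information quantities are in bits. *)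

(* Defs.v *)
From HB Require Import structures.
From mathcomp Require Import all_boot all_order all_algebra.
From mathcomp Require Import all_classical all_reals all_analysis.

Set Implicit Arguments.
Unset Strict Implicit.
Unset Printing Implicit Defensive.

Import Order.TTheory GRing.Theory Num.Theory.
Import numFieldNormedType.Exports.

Local Open Scope classical_set_scope.
Local Open Scope ring_scope.

Definition is_pmf (R : realType) (T : finType) (p : T -> R) : Prop :=
  (forall t, 0 <= p t) /\ \sum_t p t = 1.

(* In the definitions below p is a pmf on a finite sample space Omega, and
   random variables are functions on Omega. *)

Definition Prob (R : realType) (Omega : finType) (p : Omega -> R)
  (E : pred Omega) : R := \sum_(o | E o) p o.

Definition Expect (R : realType) (Omega : finType) (p : Omega -> R)
  (f : Omega -> R) : R := \sum_o p o * f o.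

Definition law (R : realType) (Omega T : finType) (p : Omega -> R)
  (A : Omega -> T) (a : T) : R := Prob p (fun o => A o == a).

(* P(A = a | C = c); the value is 0 when P(C = c) = 0, since 0^-1 = 0. *)
Definition cond_law (R : realType) (Omega T V : finType) (p : Omega -> R)
  (A : Omega -> T) (C : Omega -> V) (a : T) (c : V) : R :=
  law p (fun o => (A o, C o)) (a, c) / law p C c.

Definition log2 (R : realType) (x : R) : R := ln x / ln 2.

(* In the next two definitions a term of probability 0 contributes 0; in every
   other term the argument of log2 is a positive real. *)
Definition mutual_info (R : realType) (Omega T1 T2 : finType) (p : Omega -> R)
  (A : Omega -> T1) (B : Omega -> T2) : R :=
  \sum_a \sum_b
    law p (fun o => (A o, B o)) (a, b) *
    log2 (law p (fun o => (A o, B o)) (a, b) / (law p A a * law p B b)).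

Definition cond_mutual_info (R : realType) (Omega T1 T2 T3 : finType)
  (p : Omega -> R) (A : Omega -> T1) (B : Omega -> T2) (C : Omega -> T3) : R :=
  \sum_a \sum_b \sum_c
    law p (fun o => (A o, B o, C o)) (a, b, c) *
    log2 (cond_law p (fun o => (A o, B o)) C (a, b) c /
          (cond_law p A C a c * cond_law p B C b c)).

(* The channel is W x s (y, z) = p(y, z | x, s). *)

Record isac_code (X S Y Z Shat : finType) (n M : nat) := IsacCode {
  encoder : 'I_M -> {ffun 'I_n -> X};
  decoder : {ffun 'I_n -> Y} -> {ffun 'I_n -> S} -> 'I_M;
  estimator : {ffun 'I_n -> Z} -> {ffun 'I_n -> Shat} }.

(* Joint pmf of (W, S^n, (Y^n, Z^n)) induced by a code. *)
Definition code_pmf (R : realType) (X S Y Z Shat : finType) (PS : S -> R)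
  (W : X -> S -> Y * Z -> R) (n M : nat) (c : isac_code X S Y Z Shat n M)
  (o : 'I_M * {ffun 'I_n -> S} * ({ffun 'I_n -> Y} * {ffun 'I_n -> Z})) : R :=
  let: (w, s, (y, z)) := o in
  M%:R^-1 * \prod_(i < n) PS (s i) *
  \prod_(i < n) W (encoder c w i) (s i) (y i, z i).

Definition error_prob (R : realType) (X S Y Z Shat : finType) (PS : S -> R)
  (W : X -> S -> Y * Z -> R) (n M : nat) (c : isac_code X S Y Z Shat n M) : R :=
  Prob (code_pmf PS W c)
    (fun o => let: (w, s, (y, z)) := o in decoder c y s != w).

Definition distortion (R : realType) (X S Y Z Shat : finType) (PS : S -> R)
  (W : X -> S -> Y * Z -> R) (d : S -> Shat -> R) (n M : nat)
  (c : isac_code X S Y Z Shat n M) : R :=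
  n%:R^-1 * \sum_(i < n)
    Expect (code_pmf PS W c)
      (fun o => let: (w, s, (y, z)) := o in d (s i) (estimator c z i)).

(* The number of messages of a (2^{nr}, n) code: the ceiling of 2^{nr}. *)
Definition num_messages (R : realType) (r : R) (n : nat) : nat :=
  `|Num.ceil (2 `^ (n%:R * r))|%N.

Definition achievable (R : realType) (X S Y Z Shat : finType) (PS : S -> R)
  (W : X -> S -> Y * Z -> R) (d : S -> Shat -> R) (r D : R) : Prop :=
  exists c : forall n, isac_code X S Y Z Shat n (num_messages r n),
    (error_prob PS W (c n) @[n --> \oo] --> (0 : R)) /\
    (limn_esup (fun n => (distortion PS W d (c n))%:E) <= D%:E)%E.

(* The largest achievable rate is taken as a supremum: a capacity need not be
   achievable by codes with exactly the ceiling of 2^{nC} messages.  The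
   supremum is in \bar R, so that no default value can occur. *)
Definition capacity_distortion (R : realType) (X S Y Z Shat : finType)
  (PS : S -> R) (W : X -> S -> Y * Z -> R) (d : S -> Shat -> R) (D : R) :
  \bar R :=
  ereal_sup [set r%:E | r in [set r : R | 0 <= r /\
                                          achievable PS W d r D]].

(* The set of values is nonempty (for nonempty X and Shat), bounded below and
   compact, so its infimum is its minimum. *)
Definition Dmin (R : realType) (X S Y Z Shat : finType) (PS : S -> R)
  (W : X -> S -> Y * Z -> R) (d : S -> Shat -> R) : R :=
  inf [set e : R | exists PX : X -> R, exists shat : Z -> Shat,
    is_pmf PX /\
    e = Expect (fun o : X * S * (Y * Z) =>
                  let: (x, s, yz) := o in PX x * PS s * W x s yz)
               (fun o => let: (x, s, (y, z)) := o in d s (shat z))].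

Section SingleLetter.
Context {U X S Y Z : finType}.

Definition single_letter_pmf (R : realType) (PUX : U * X -> R) (PS : S -> R)
  (W : X -> S -> Y * Z -> R) (o : U * X * S * (Y * Z)) : R :=
  let: (u, x, s, yz) := o in PUX (u, x) * PS s * W x s yz.

Definition rvU (o : U * X * S * (Y * Z)) : U := o.1.1.1.
Definition rvX (o : U * X * S * (Y * Z)) : X := o.1.1.2.
Definition rvS (o : U * X * S * (Y * Z)) : S := o.1.2.
Definition rvY (o : U * X * S * (Y * Z)) : Y := o.2.1.
Definition rvZ (o : U * X * S * (Y * Z)) : Z := o.2.2.

End SingleLetter.

(* shat is a version of the arg min estimator, for some rule of breaking ties.
   Where P(U = u, Z = z) = 0 the posterior is 0 and shat u z is arbitrary. *)
Definition optimal_estimator (R : realType) (U X S Y Z Shat : finType)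
  (p : U * X * S * (Y * Z) -> R) (d : S -> Shat -> R)
  (shat : U -> Z -> Shat) : Prop :=
  forall (u : U) (z : Z) (s' : Shat),
    \sum_s cond_law p rvS (fun o => (rvU o, rvZ o)) s (u, z) * d s (shat u z)
    <= \sum_s cond_law p rvS (fun o => (rvU o, rvZ o)) s (u, z) * d s s'.

(* The values of the objective over the feasible P_UX.  All versions of the
   arg min estimator have the same expected distortion. *)
Definition feasible_rates (R : realType) (X S Y Z Shat : finType)
  (PS : S -> R) (W : X -> S -> Y * Z -> R) (d : S -> Shat -> R) (D : R) :
  set R :=
  [set r | exists (U : finType) (PUX : U * X -> R) (shat : U -> Z -> Shat),
    let p := single_letter_pmf PUX PS W in
    [/\ (#|U| <= #|X| + 1)%N,
        is_pmf PUX,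
        optimal_estimator p d shat,
        Expect p (fun o => d (rvS o) (shat (rvU o) (rvZ o))) <= D
      & r = Num.min
              (mutual_info p rvU rvZ +
               cond_mutual_info p rvX rvY (fun o => (rvU o, rvS o)))
              (cond_mutual_info p rvX rvY rvS)]].

(* Main.v *)
Require Import Defs.
From HB Require Import structures.
From mathcomp Require Import all_boot all_order all_algebra.
From mathcomp Require Import all_classical all_reals all_analysis.
From mathcomp Require Import ring lra.

Import Order.TTheory GRing.Theory Num.Theory.
Import numFieldNormedType.Exports.

Local Open Scope classical_set_scope.
Local Open Scope ring_scope.

Set Implicit Arguments.
Unset Strict Implicit.

(* Superposition coding.  Cloud centres u^n(k) are drawn i.i.d. from P_U, and
   each message w has a satellite x^n(w) drawn from P_{X|U} given the centre of
   its cloud c(w).  The sensing receiver decodes only the cloud, and then applies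
   the single-letter estimator to (u_i, z_i); the communication receiver decodes
   the message.  Each of the three information quantities is a divergence
   D(P||Q), where Q is the law of the tuple that a wrong codeword presents to the
   receiver: P_U P_Z for a wrong cloud, P_{X|U} P_{YUS} for a wrong satellite of
   the right cloud, and P_X P_{YS} for a satellite of a wrong cloud.  Likelihood-
   ratio tests therefore make all error terms exponentially small.  When the cloud
   is decoded correctly the mean distortion is exactly the single-letter one, so
   the excess distortion is exponentially small too, and D itself (not D +
   epsilon) is attained.

   The maximum exists because, written with entropies, the objective is
   continuous in P_UX, the feasible set is a finite union of compact sets (one for
   each |U| and each estimator), and U may be relabelled to {0, ..., |U| - 1}.  The
   feasible set is not empty because the distortion is linear in P_X, so that
   Dmin is attained at a deterministic input. *)

(** * Sums over product spaces and likelihood-ratio tests *)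

Section FiniteProducts.
Variable R : realType.

Lemma sum_pointr (T : finType) (a : T) (F : T -> R) :
  \sum_t F t * (t == a)%:R = F a.
Proof.
rewrite (bigD1 a) //= eqxx mulr1 big1 ?addr0 // => t /negPf ->.
by rewrite mulr0.
Qed.

Lemma prod_indicator (I : finType) (Q : I -> bool) :
  \prod_i (Q i)%:R = [forall i, Q i]%:R :> R.
Proof.
case: forallP => [h|/forallP]; first by rewrite big1 // => i _; rewrite h.
rewrite negb_forall => /existsP[i /negPf Qi].
by rewrite (bigD1 i) //= Qi mul0r.
Qed.

Lemma sum_ffun_pmf (I T : finType) (P : I -> T -> R) :
  (forall i, \sum_t P i t = 1) -> \sum_(f : {ffun I -> T}) \prod_i P i (f i) = 1.
Proof. by move=> P1; rewrite -bigA_distr_bigA big1. Qed.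

(** [F] is absorbed into the [i]-th factor, after which the sum over functions factors over
    coordinates and all other factors sum to 1. The factors may differ from one coordinate to
    another, because satellites of different clouds are drawn from different kernels. *)
Lemma marginal1 (I T : finType) (P : I -> T -> R) (i : I) (F : T -> R) :
  (forall l, \sum_t P l t = 1) ->
  \sum_(f : {ffun I -> T}) \prod_l P l (f l) * F (f i) = \sum_a P i a * F a.
Proof.
move=> P1.
pose G l t := P l t * (if l == i then F t else 1).
transitivity (\sum_(f : {ffun I -> T}) \prod_l G l (f l)).
  apply: eq_bigr => f _; rewrite big_split /=; congr (_ * _).
  by rewrite -big_mkcond /= big_pred1_eq.
rewrite -bigA_distr_bigA (bigD1 i) //=.
rewrite [X in _ * X]big1 => [|l /negPf li].
  by rewrite mulr1; apply: eq_bigr => t _; rewrite /G eqxx.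
by rewrite -[RHS](P1 l); apply: eq_bigr => t _; rewrite /G li mulr1.
Qed.

(** [F] need not be a product, so it is first expanded over the value [a] of [f i] by an indicator.
    For fixed [a] the indicator is absorbed into factor [i] and [F a] into factor [j]. *)
Lemma marginal2 (I T : finType) (P : I -> T -> R) (i j : I)
    (F : T -> T -> R) :
  (forall l, \sum_t P l t = 1) -> i != j ->
  \sum_(f : {ffun I -> T}) \prod_l P l (f l) * F (f i) (f j) =
  \sum_a P i a * \sum_b P j b * F a b.
Proof.
move=> P1 ij; have ji : j != i by rewrite eq_sym.
transitivity (\sum_(f : {ffun I -> T}) \sum_a
    \prod_l (P l (f l) * (if l == i then (f l == a)%:R else 1)) * F a (f j)).
  apply: eq_bigr => f _; rewrite -[F (f i) _](sum_pointr (f i) (F^~ (f j))).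
  rewrite mulr_sumr; apply: eq_bigr => a _.
  rewrite big_split /= -big_mkcond big_pred1_eq eq_sym; lra.
rewrite exchange_big; apply: eq_bigr => a _ /=.
pose G l t := P l t * (if l == i then (t == a)%:R
                       else if l == j then F a t else 1).
transitivity (\sum_(f : {ffun I -> T}) \prod_l G l (f l)).
  apply: eq_bigr => f _.
  rewrite !big_split /= -mulrA; congr (_ * _).
  rewrite -big_mkcond big_pred1_eq (bigD1 i) //= eqxx; congr (_ * _).
  rewrite (bigD1 j ji) /= eqxx (negPf ji).
  rewrite big1 ?mulr1 // => l.
  by move=> /andP[/negPf -> /negPf ->].
rewrite -bigA_distr_bigA (bigD1 i) //= (bigD1 j ji) /=.
rewrite [X in _ * (_ * X)]big1 => [|l].
  rewrite mulr1; congr (_ * _).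
    rewrite -[RHS](sum_pointr a (P i)); apply: eq_bigr => t _.
    by rewrite /G eqxx.
  by apply: eq_bigr => t _; rewrite /G eqxx eq_sym (negPf ij).
move=> /andP[/negPf li /negPf lj]; rewrite -[RHS](P1 l).
by apply: eq_bigr => t _; rewrite /G li lj mulr1.
Qed.

Lemma lawE (T V : finType) (p : T -> R) (f : T -> V) v :
  law p f v = \sum_t p t * (f t == v)%:R.
Proof.
rewrite /law /Prob big_mkcond; apply: eq_bigr => t _.
by case: eqP; rewrite (mulr1, mulr0).
Qed.

Lemma sum_law (T V : finType) (p : T -> R) (f : T -> V) (F : V -> R) :
  \sum_t p t * F (f t) = \sum_v law p f v * F v.
Proof.
under [RHS]eq_bigr => v _ do rewrite lawE mulr_suml.
rewrite exchange_big; apply: eq_bigr => t _ /=.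
rewrite -[F (f t)](sum_pointr (f t)) mulr_sumr; apply: eq_bigr => v _.
rewrite eq_sym; lra.
Qed.

(** Transfers an average over blocks of outcomes to the alphabet on which a test is defined. It
    holds because the preimage of a block [v] is a product set, so its probability is a product of
    single-letter laws. *)
Lemma prod_law (I T V : finType) (p : T -> R) (f : T -> V)
    (F : {ffun I -> V} -> R) :
  \sum_(t : {ffun I -> T}) \prod_i p (t i) * F [ffun i => f (t i)] =
  \sum_(v : {ffun I -> V}) \prod_i law p f (v i) * F v.
Proof.
rewrite (sum_law (fun t : {ffun I -> T} => \prod_i p (t i))
  (fun t : {ffun I -> T} => [ffun i => f (t i)])).
apply: eq_bigr => v _; congr (_ * _).
under [RHS]eq_bigr => i _ do rewrite lawE.
rewrite bigA_distr_bigA lawE; apply: eq_bigr => t _ /=.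
rewrite big_split /=; congr (_ * _); rewrite prod_indicator; congr (_%:R).
congr nat_of_bool; apply/eqP/forallP => [<- i|h]; first by rewrite ffunE.
by apply/ffunP => i; rewrite ffunE; apply/eqP.
Qed.

Lemma sum_unzip (I A B : finType) (G : {ffun I -> A} -> {ffun I -> B} -> R) :
  \sum_a \sum_b G a b =
  \sum_(t : {ffun I -> A * B}) G [ffun i => (t i).1] [ffun i => (t i).2].
Proof.
rewrite pair_bigA /=.
rewrite (reindex (fun t : {ffun I -> A * B} =>
  ([ffun i => (t i).1] : {ffun I -> A}, [ffun i => (t i).2] : {ffun I -> B}))).
  by [].
exists (fun ab : {ffun I -> A} * {ffun I -> B} => [ffun i => (ab.1 i, ab.2 i)])
    => /= [t _|[a b] _].
  by apply/ffunP => i; rewrite !ffunE -surjective_pairing.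
by congr pair; apply/ffunP => i; rewrite !ffunE.
Qed.

Lemma pmf_law (T V : finType) (p : T -> R) (f : T -> V) :
  is_pmf p -> is_pmf (law p f).
Proof.
move=> [p0 p1]; split=> [v|]; first exact: sumr_ge0.
rewrite -p1; under [RHS]eq_bigr => t _ do rewrite -[p t]mulr1.
rewrite (sum_law p f (fun=> 1)).
by apply: eq_bigr => v _; rewrite mulr1.
Qed.

(** The averaging argument that extracts one codebook from the random ensemble. If every value
    exceeded [b], the nonnegative terms [p t * (F t - b)] would all vanish, and [p] with them. *)
Lemma exists_le_mean (T : finType) (p F : T -> R) (b : R) :
  is_pmf p -> \sum_t p t * F t <= b -> exists t, F t <= b.
Proof.
move=> [p0 p1] Fb; apply: contrapT => /forallNP H.
have : \sum_t p t * (F t - b) <= 0.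
  under eq_bigr => t _ do rewrite mulrBr.
  by rewrite sumrB -mulr_suml p1 mul1r subr_le0.
have ge t : true -> 0 <= p t * (F t - b).
  by move=> _; rewrite mulr_ge0 // subr_ge0 ltW // ltNge; apply/negP/H.
rewrite le_eqVlt ltNge sumr_ge0 // orbF psumr_eq0 // => /allP h.
suff : \sum_t p t = 0 by rewrite p1 => /eqP; rewrite oner_eq0.
apply: big1 => t _; have := h t (mem_index_enum _).
rewrite mulf_eq0 => /orP[/eqP //|/eqP].
by move/(fun e => H t ltac:(lra)).
Qed.

End FiniteProducts.

(** * Chernoff bound and exponential decay for a likelihood-ratio test *)

Section Stein.
Variable R : realType.

(** From [1 - x <= expR (- x)] one gets [(1 - x) * expR x <= 1], while
    [(1 - x) * (1 + x + 2 * x ^+ 2)] equals [1 + x ^+ 2 * (1 - 2 * x)], which is at least 1 in this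
    range. *)
Lemma expR_le_quad (x : R) : x <= 2^-1 -> expR x <= 1 + x + 2 * x ^+ 2.
Proof.
move=> x2; have e := expR_ge1Dx (- x).
have : expR x * expR (- x) = 1 by rewrite expRN divff // gt_eqF // expR_gt0.
have := expR_gt0 x; move: e; set a := expR x; set b := expR _ => e a0 ab.
have : (1 - x) * a <= (1 - x) * (1 + x + 2 * x ^+ 2); last first.
  by rewrite ler_pM2l //; lra.
apply: (@le_trans _ _ 1); first by rewrite -ab [leRHS]mulrC ler_pM2r //; lra.
have := mulr_ge0 (sqr_ge0 x) (_ : 0 <= 1 - 2 * x); rewrite subr_ge0.
move=> /(_ ltac:(lra)); rewrite !expr2; nra.
Qed.

(** For small [s] the generating function of [- g] is 1 minus [s] times the mean, up to a quadratic
    term. An explicit [s] replaces the argument by derivatives. *)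
Lemma chernoff_tilt (T : finType) (P g : T -> R) :
  is_pmf P -> 0 < \sum_t P t * g t ->
  exists2 s : R, 0 < s & \sum_t P t * expR (- (s * g t)) < 1.
Proof.
move=> [P0 P1]; set mu := \sum_t _ => mu0.
pose B := 1 + \sum_t `|g t|.
have B1 : 1 <= B by rewrite lerDl sumr_ge0.
have gB t : `|g t| <= B.
  rewrite /B (bigD1 t) //= addrCA lerDl addr_ge0 // sumr_ge0 //.
(* The first bound keeps [- (s * g t)] in the range of [expR_le_quad]; the second makes the
   quadratic term at most half of the linear gain [s * mu]. *)
pose s := Num.min (2 * B)^-1 (mu / (4 * B ^+ 2)).
have s0 : 0 < s by rewrite lt_min invr_gt0 divr_gt0 // ?mulr_gt0 ?exprn_gt0 //; lra.
have sB : s * B <= 2^-1.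
  have : s <= (2 * B)^-1 by rewrite ge_min lexx.
  rewrite invfM -ler_pdivlMr //; lra.
have smu : 4 * (s * B ^+ 2) <= mu.
  have : s <= mu / (4 * B ^+ 2) by rewrite ge_min lexx orbT.
  rewrite ler_pdivlMr ?mulr_gt0 ?exprn_gt0 //; lra.
exists s => //.
apply: (@le_lt_trans _ _ (\sum_t (P t - s * (P t * g t) + 2 * s ^+ 2 * B ^+ 2 * P t))).
  apply: ler_sum => t _.
  have h : - (s * g t) <= 2^-1.
    apply: le_trans sB; rewrite -mulrN ler_pM2l //.
    by apply: le_trans (gB t); rewrite ler_normr lexx orbT.
  apply: le_trans (ler_wpM2l (P0 t) (expR_le_quad h)) _.
  rewrite sqrrN exprMn.
  have : g t ^+ 2 <= B ^+ 2 by rewrite -real_normK ?num_real // lerXn2r ?nnegrE //; lra.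
  move=> /(ler_wpM2l (sqr_ge0 s)) /(ler_wpM2l (P0 t)); lra.
rewrite big_split /= sumrB -!mulr_sumr P1 -/mu mulr1.
have := mulr_gt0 s0 mu0; have := ler_wpM2l (ltW s0) smu.
rewrite !expr2; lra.
Qed.

(* The achievability half of Stein's lemma. *)
Lemma stein (T : finType) (P Q : T -> R) (r : R) :
  is_pmf P -> (forall t, 0 <= Q t) -> (forall t, Q t = 0 -> P t = 0) ->
  r < \sum_t P t * log2 (P t / Q t) ->
  exists2 rho : R, 0 <= rho < 1 & forall n,
  exists A : pred {ffun 'I_n -> T},
    \sum_(t : {ffun 'I_n -> T}) \prod_i P (t i) * (~~ A t)%:R <= rho ^+ n /\
    \sum_(t : {ffun 'I_n -> T}) \prod_i Q (t i) * (A t)%:R <= 2 `^ (- (n%:R * r)).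
Proof.
move=> Ppmf Q0 PQ rP; have [P0 P1] := Ppmf.
have ln2 : 0 < ln 2 :> R by rewrite ln_gt0 // ltr1n.
(* Log-likelihood ratio in nats, centred at the threshold [r]: the assumption on [r] says that its
   mean under [P] is positive, and the test accepts when its sum over the block is nonnegative. *)
pose g t := ln (P t / Q t) - r * ln 2.
have [|s s0 hs] := @chernoff_tilt T P g Ppmf.
  under eq_bigr => t _ do rewrite mulrBr.
  rewrite sumrB -mulr_suml P1 mul1r subr_gt0.
  move: rP; under eq_bigr => t _ do rewrite /log2 mulrA.
  by rewrite -mulr_suml ltr_pdivlMr.
exists (\sum_t P t * expR (- (s * g t))).
  by rewrite hs sumr_ge0 // => t _; rewrite mulr_ge0 // expR_ge0.
move=> n.
(* Where P vanishes, g carries the junk value of ln; these tuples are rejected. *)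
exists (fun t : {ffun 'I_n -> T} =>
  [forall i, P (t i) != 0] && (0 <= \sum_i g (t i))); split.
  have -> : (\sum_t P t * expR (- (s * g t))) ^+ n =
    \prod_(i < n) \sum_t P t * expR (- (s * g t)) :> R.
    by rewrite prodr_const card_ord.
  rewrite bigA_distr_bigA; apply: ler_sum => t _ /=.
  have ge0 : 0 <= \prod_(i < n) (P (t i) * expR (- (s * g (t i)))).
    by apply: prodr_ge0 => i _; rewrite mulr_ge0 // expR_ge0.
  case: (boolP [forall i, P (t i) != 0]) => [_|]; last first.
    rewrite negb_forall => /existsP[i /negPn/eqP Pi].
    by rewrite (bigD1 i) //= Pi !mul0r.
  case: (leP 0 (\sum_(i < n) g (t i))) => /= h; rewrite ?mulr0 ?mulr1 //.
  rewrite big_split /= ler_peMr ?prodr_ge0 //.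
  rewrite -expR_sum -expR0 ler_expR sumrN oppr_ge0 -mulr_sumr.
  by rewrite pmulr_rle0 // ltW.
have -> : 2 `^ (- (n%:R * r)) = 2 `^ (- (n%:R * r)) *
    \sum_(t : {ffun 'I_n -> T}) \prod_i P (t i).
  by rewrite (@sum_ffun_pmf R 'I_n T (fun=> P)) ?mulr1.
rewrite mulr_sumr; apply: ler_sum => t _.
case: (boolP [forall i, _]) => [/forallP h|_] /=; last first.
  by rewrite mulr0 mulr_ge0 ?powR_ge0 // prodr_ge0.
case: (leP 0 (\sum_(i < n) g (t i))) => /= hg; last first.
  by rewrite mulr0 mulr_ge0 ?powR_ge0 // prodr_ge0.
rewrite mulr1.
have Pp i : 0 < P (t i) by rewrite lt_neqAle eq_sym h P0.
have Qp i : 0 < Q (t i).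
  by rewrite lt_neqAle Q0 andbT eq_sym; apply: contra_neq (h i) => /PQ.
have QE i : Q (t i) = P (t i) * expR (- (g (t i) + r * ln 2)).
  rewrite /g subrK expRN lnK ?posrE ?divr_gt0 //.
  by rewrite invf_div mulrCA divff ?mulr1 // gt_eqF.
rewrite (eq_bigr _ (fun i _ => QE i)) big_split /= mulrC ler_wpM2r ?prodr_ge0 //.
rewrite -expR_sum /powR pnatr_eq0 /= ler_expR sumrN big_split /= sumr_const.
rewrite card_ord -mulr_natl; lra.
Qed.

End Stein.

(** * Random superposition codebooks *)

Section RandomCoding.
Variable R : realType.

(** Union bound for a decoder that picks any candidate passing a test: it errs only if the true
    candidate fails or a wrong one passes. The default [t0] is output only when all candidates fail,
    which the first term covers. *)
Lemma pick_error (T : finType) (Q : pred T) (t0 t : T) :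
  (odflt t0 [pick t | Q t] != t)%:R <=
  (~~ Q t)%:R + \sum_(t' | t' != t) (Q t')%:R :> R.
Proof.
have S0 : 0 <= \sum_(t' | t' != t) (Q t')%:R :> R by exact: sumr_ge0.
case: (boolP (Q t)) => [Qt|_] /=; last first.
  by apply: ler_wpDr => //; rewrite ler_nat; case: (_ != _).
rewrite add0r; case: pickP => [t' Qt'|/(_ t)] /=; last by rewrite Qt.
case: (boolP (t' != t)) => // t't.
by rewrite (bigD1 t') //= Qt' lerDl sumr_ge0.
Qed.

Variables (U X S Y Z Idx Msg : finType) (c : Msg -> Idx).
Variables (PU : U -> R) (K : U -> X -> R) (PS : S -> R).
Variable W : X -> S -> Y * Z -> R.
Hypothesis PU_pmf : is_pmf PU.
Hypothesis K_pmf : forall u, is_pmf (K u).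
Hypothesis PS_pmf : is_pmf PS.
Hypothesis W_pmf : forall x s, is_pmf (W x s).

(** The random-coding argument is carried out for one use of abstract alphabets. They become spaces
    of n-tuples in [superposition_codes], with [iid], [memoryless_input] and [memoryless] as the
    laws. *)
Definition channel_mean (x : X) (G : S -> Y * Z -> R) : R :=
  \sum_s PS s * \sum_yz W x s yz * G s yz.

Definition joint_mean (G : U -> X -> S -> Y * Z -> R) : R :=
  \sum_u PU u * \sum_x K u x * channel_mean x (G u x).

(* Cloud centres, indexed by Idx, and satellites; c w is the cloud of w. *)
Definition codebook_pmf (b : {ffun Idx -> U} * {ffun Msg -> X}) : R :=
  \prod_k PU (b.1 k) * \prod_w K (b.1 (c w)) (b.2 w).

Lemma codebook_pmf_is_pmf : is_pmf codebook_pmf.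
Proof.
have [U0 U1] := PU_pmf; split=> [b|].
  rewrite mulr_ge0 ?prodr_ge0 // => w _.
  by have [] := K_pmf (b.1 (c w)).
rewrite -(pair_bigA _ (fun u x => codebook_pmf (u, x))) /codebook_pmf /=.
transitivity (\sum_(u : {ffun Idx -> U}) \prod_k PU (u k)); last first.
  exact: (@sum_ffun_pmf R Idx U (fun=> PU)).
apply: eq_bigr => u _; rewrite -mulr_sumr.
rewrite (@sum_ffun_pmf R Msg X (fun w => K (u (c w)))) ?mulr1 //.
by move=> w; have [] := K_pmf (u (c w)).
Qed.

Let K1 (u : {ffun Idx -> U}) w : \sum_x K (u (c w)) x = 1.
Proof. by have [] := K_pmf (u (c w)). Qed.

Lemma codebook_mean1 w (F : U -> X -> R) :
  \sum_b codebook_pmf b * F (b.1 (c w)) (b.2 w) =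
  \sum_u PU u * \sum_x K u x * F u x.
Proof.
rewrite -(pair_bigA _ (fun u x => codebook_pmf (u, x) * F (u (c w)) (x w))) /=.
rewrite -(@marginal1 R Idx U (fun=> PU) (c w)
  (fun u => \sum_x K u x * F u x)) => [|_]; last by case: PU_pmf.
apply: eq_bigr => u _; rewrite -(marginal1 _ _ (K1 u)) mulr_sumr.
by apply: eq_bigr => x _; rewrite mulrA.
Qed.

(** Two satellites of one cloud are independent given their common centre, but not unconditionally:
    the wrong codeword [x'] still depends on the true [u]. *)
Lemma codebook_mean_same w w' (F : U -> X -> X -> R) :
  w != w' -> c w' = c w ->
  \sum_b codebook_pmf b * F (b.1 (c w)) (b.2 w) (b.2 w') =
  \sum_u PU u * \sum_x K u x * \sum_x' K u x' * F u x x'.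
Proof.
move=> ww' cc.
rewrite -(pair_bigA _ (fun u x => codebook_pmf (u, x) *
  F (u (c w)) (x w) (x w'))) /=.
rewrite -(@marginal1 R Idx U (fun=> PU) (c w)
  (fun u => \sum_x K u x * \sum_x' K u x' * F u x x')) => [|_]; last first.
  by case: PU_pmf.
apply: eq_bigr => u _.
have := marginal2 (F (u (c w))) (K1 u) ww'; rewrite /= cc => <-.
rewrite mulr_sumr.
by apply: eq_bigr => x _; rewrite mulrA.
Qed.

(** Satellites of distinct clouds are fully independent. The satellites are integrated out first
    with all centres fixed, then the two centres. *)
Lemma codebook_mean_other w w' (F : U -> X -> U -> X -> R) :
  c w != c w' ->
  \sum_b codebook_pmf b * F (b.1 (c w)) (b.2 w) (b.1 (c w')) (b.2 w') =
  \sum_u PU u * \sum_x K u x *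
    \sum_u' PU u' * \sum_x' K u' x' * F u x u' x'.
Proof.
move=> cc; have ww' : w != w' by apply: contra_neq cc => ->.
rewrite -(pair_bigA _ (fun u x => codebook_pmf (u, x) *
  F (u (c w)) (x w) (u (c w')) (x w'))) /=.
transitivity (\sum_(u : {ffun Idx -> U}) \prod_k PU (u k) *
    \sum_x K (u (c w)) x *
    \sum_x' K (u (c w')) x' * F (u (c w)) x (u (c w')) x').
  apply: eq_bigr => u _; rewrite -(marginal2 _ (K1 u) ww') mulr_sumr.
  by apply: eq_bigr => x _; rewrite mulrA.
rewrite (@marginal2 R Idx U (fun=> PU) (c w) (c w') (fun u u' => \sum_x K u x *
  \sum_x' K u' x' * F u x u' x') _ cc) => [|_]; last by case: PU_pmf.
apply: eq_bigr => u _; congr (_ * _).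
under eq_bigr => u' _ do rewrite mulr_sumr.
rewrite exchange_big; apply: eq_bigr => x _; rewrite mulr_sumr.
by apply: eq_bigr => u' _; rewrite mulrCA.
Qed.

(** Here [k] is a bare cloud index, possibly of a cloud without messages: the sensing receiver tests
    every centre, not only those of occupied clouds. *)
Lemma codebook_mean_idx w k (F : U -> X -> U -> R) :
  c w != k ->
  \sum_b codebook_pmf b * F (b.1 (c w)) (b.2 w) (b.1 k) =
  \sum_u PU u * \sum_x K u x * \sum_u' PU u' * F u x u'.
Proof.
move=> ck.
rewrite -(pair_bigA _ (fun u x => codebook_pmf (u, x) *
  F (u (c w)) (x w) (u k))) /=.
transitivity (\sum_(u : {ffun Idx -> U}) \prod_k PU (u k) *
    \sum_x K (u (c w)) x * F (u (c w)) x (u k)).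
  apply: eq_bigr => u _.
  rewrite -(marginal1 w (fun x => F (u (c w)) x (u k)) (K1 u)) mulr_sumr.
  by apply: eq_bigr => x _; rewrite mulrA.
rewrite (@marginal2 R Idx U (fun=> PU) (c w) k (fun u u' =>
  \sum_x K u x * F u x u') _ ck) => [|_]; last by case: PU_pmf.
apply: eq_bigr => u _; congr (_ * _).
under eq_bigr => u' _ do rewrite mulr_sumr.
rewrite exchange_big; apply: eq_bigr => x _; rewrite mulr_sumr.
by apply: eq_bigr => u' _; rewrite mulrCA.
Qed.

Lemma le_channel_mean x G1 G2 : (forall s yz, G1 s yz <= G2 s yz) ->
  channel_mean x G1 <= channel_mean x G2.
Proof.
move=> h; apply: ler_sum => s _; apply: ler_wpM2l; first by case: PS_pmf.
by apply: ler_sum => yz _; apply: ler_wpM2l => //; case: (W_pmf x s).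
Qed.

Lemma channel_meanD x G1 G2 :
  channel_mean x (fun s yz => G1 s yz + G2 s yz) =
  channel_mean x G1 + channel_mean x G2.
Proof.
rewrite -big_split; apply: eq_bigr => s _ /=; rewrite -mulrDr -big_split.
by congr (_ * _); apply: eq_bigr => yz _; rewrite mulrDr.
Qed.

Lemma channel_meanZ x a G :
  channel_mean x (fun s yz => a * G s yz) = a * channel_mean x G.
Proof.
rewrite mulr_sumr; apply: eq_bigr => s _ /=; rewrite mulrCA; congr (_ * _).
by rewrite mulr_sumr; apply: eq_bigr => yz _; rewrite mulrCA.
Qed.

Lemma channel_mean_sum (I : finType) (Q : pred I) x G :
  channel_mean x (fun s yz => \sum_(i | Q i) G i s yz) =
  \sum_(i | Q i) channel_mean x (G i).
Proof.
rewrite exchange_big; apply: eq_bigr => s _ /=; rewrite -mulr_sumr.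
congr (_ * _); rewrite exchange_big; apply: eq_bigr => yz _ /=.
by rewrite mulr_sumr.
Qed.

Lemma channel_mean_ge0 x G : (forall s yz, 0 <= G s yz) ->
  0 <= channel_mean x G.
Proof.
move=> G0; apply: sumr_ge0 => s _; apply: mulr_ge0; first by case: PS_pmf.
by apply: sumr_ge0 => yz _; apply: mulr_ge0 => //; case: (W_pmf x s).
Qed.

Lemma joint_mean_ge0 G : (forall u x s yz, 0 <= G u x s yz) ->
  0 <= joint_mean G.
Proof.
move=> G0; apply: sumr_ge0 => u _; apply: mulr_ge0; first by case: PU_pmf.
apply: sumr_ge0 => x _; apply: mulr_ge0; first by case: (K_pmf u).
exact: channel_mean_ge0.
Qed.

Lemma le_joint_mean G1 G2 : (forall u x s yz, G1 u x s yz <= G2 u x s yz) ->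
  joint_mean G1 <= joint_mean G2.
Proof.
move=> h; apply: ler_sum => u _; apply: ler_wpM2l; first by case: PU_pmf.
apply: ler_sum => x _; apply: ler_wpM2l; first by case: (K_pmf u).
exact: le_channel_mean.
Qed.

Lemma joint_meanD G1 G2 :
  joint_mean (fun u x s yz => G1 u x s yz + G2 u x s yz) =
  joint_mean G1 + joint_mean G2.
Proof.
rewrite -big_split; apply: eq_bigr => u _ /=; rewrite -mulrDr -big_split.
congr (_ * _); apply: eq_bigr => x _; rewrite channel_meanD.
by rewrite mulrDr.
Qed.

Variables (B : U -> X -> S -> Y -> bool) (A : U -> Z -> bool).
Variables (w0 : Msg) (k0 : Idx).
Implicit Types b : {ffun Idx -> U} * {ffun Msg -> X}.

Definition threshold_decoder b (y : Y) (s : S) : Msg :=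
  odflt w0 [pick w | B (b.1 (c w)) (b.2 w) s y].

Definition cloud_decoder b (z : Z) : Idx := odflt k0 [pick k | A (b.1 k) z].

Variables (alpha beta2 beta3 alpha1 gamma Delta : R).
Hypothesis B_miss : joint_mean (fun u x s yz => (~~ B u x s yz.1)%:R) <= alpha.
Hypothesis B_same :
  joint_mean (fun u x s yz => \sum_x' K u x' * (B u x' s yz.1)%:R) <= beta2.
Hypothesis B_other :
  joint_mean (fun u x s yz =>
    \sum_u' PU u' * \sum_x' K u' x' * (B u' x' s yz.1)%:R) <= beta3.
Hypothesis A_miss : joint_mean (fun u x s yz => (~~ A u yz.2)%:R) <= alpha1.
Hypothesis A_other :
  joint_mean (fun u x s yz => \sum_u' PU u' * (A u' yz.2)%:R) <= gamma.

Let K0 u x : 0 <= K u x. Proof. by case: (K_pmf u). Qed.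
Let PU0 u : 0 <= PU u. Proof. by case: PU_pmf. Qed.

Variables (m1 m2 m3 : nat).
Hypothesis m1P : (#|Idx| <= m1.+1)%N.
Hypothesis m2P : forall w, (#|[pred w' | (w' != w) && (c w' == c w)]| <= m2)%N.
Hypothesis m3P : (#|Msg| <= m3.+1)%N.

(** Union bound over the wrong messages, split by whether they share the cloud of [w], since the two
    kinds present different laws to the receiver. *)
Lemma mean_decoding_error w :
  \sum_b codebook_pmf b *
    channel_mean (b.2 w) (fun s yz => (threshold_decoder b yz.1 s != w)%:R) <=
  alpha + m2%:R * beta2 + m3%:R * beta3.
Proof.
have [cb0 _] := codebook_pmf_is_pmf.
apply: (@le_trans _ _ (\sum_b (codebook_pmf b * channel_mean (b.2 w)
     (fun s yz => (~~ B (b.1 (c w)) (b.2 w) s yz.1)%:R) +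
   \sum_(w' | w' != w) codebook_pmf b * channel_mean (b.2 w)
     (fun s yz => (B (b.1 (c w')) (b.2 w') s yz.1)%:R)))).
  apply: ler_sum => b _; rewrite -mulr_sumr -mulrDr -channel_mean_sum.
  rewrite -channel_meanD; apply: ler_wpM2l => //; apply: le_channel_mean.
  by move=> s yz; exact: pick_error.
rewrite big_split /= -addrA; apply: lerD.
  by rewrite (codebook_mean1 w (fun u x =>
    channel_mean x (fun s yz => (~~ B u x s yz.1)%:R))).
rewrite exchange_big /= (bigID (fun w' => c w' == c w)) /=.
have b2 : 0 <= beta2.
  apply: le_trans B_same; apply: joint_mean_ge0 => u x s yz.
  by apply: sumr_ge0 => x' _; rewrite mulr_ge0.
have b3 : 0 <= beta3.
  apply: le_trans B_other; apply: joint_mean_ge0 => u x s yz.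
  by apply: sumr_ge0 => u' _; rewrite mulr_ge0 // sumr_ge0 // => x' _; rewrite mulr_ge0.
apply: lerD.
  apply: (@le_trans _ _ (\sum_(w' | (w' != w) && (c w' == c w)) beta2)); last first.
    rewrite sumr_const -[leLHS]mulr_natl; apply: ler_wpM2r => //.
    by rewrite ler_nat; exact: m2P.
  apply: ler_sum => w' /andP[w'w /eqP cc]; rewrite cc.
  rewrite (codebook_mean_same (fun u x x' =>
    channel_mean x (fun s yz => (B u x' s yz.1)%:R)) _ cc) 1?eq_sym //.
  apply: le_trans B_same; rewrite le_eqVlt; apply/orP; left; apply/eqP.
  apply: eq_bigr => u _; congr (_ * _); apply: eq_bigr => x _; congr (_ * _).
  by rewrite channel_mean_sum; apply: eq_bigr => x' _; rewrite channel_meanZ.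
(* The messages of other clouds are bounded in number by all wrong messages; this is cheap because
   the third test is tuned to the full rate. *)
apply: (@le_trans _ _ (\sum_(w' | w' != w) beta3)); last first.
  rewrite sumr_const -[leLHS]mulr_natl; apply: ler_wpM2r => //; rewrite ler_nat.
  by rewrite cardC1 -subn1 leq_subLR add1n.
apply: (@le_trans _ _ (\sum_(w' | (w' != w) && (c w' != c w)) beta3)); last first.
  by rewrite [leRHS](bigID (fun w' => c w' == c w)) /= lerDr sumr_ge0.
apply: ler_sum => w' /andP[w'w cc].
rewrite (codebook_mean_other (fun u x u' x' =>
  channel_mean x (fun s yz => (B u' x' s yz.1)%:R))) 1?eq_sym //.
apply: le_trans B_other; rewrite le_eqVlt; apply/orP; left; apply/eqP.
apply: eq_bigr => u _; congr (_ * _); apply: eq_bigr => x _; congr (_ * _).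
rewrite channel_mean_sum; apply: eq_bigr => u' _; rewrite channel_meanZ.
congr (_ * _).
by rewrite channel_mean_sum; apply: eq_bigr => x' _; rewrite channel_meanZ.
Qed.

Variables (delta : S -> U -> Z -> R) (dmax : R).
Hypothesis delta_ge0 : forall s u z, 0 <= delta s u z.
Hypothesis delta_le : forall s u z, delta s u z <= dmax.
Hypothesis dmax_ge0 : 0 <= dmax.
Hypothesis delta_mean : joint_mean (fun u x s yz => delta s u yz.2) <= Delta.

(** The distortion with the decoded centre is at most that with the true centre plus [dmax] times
    the indicator of a cloud error. Hence the single-letter mean enters without conditioning on
    correct decoding. *)
Lemma mean_distortion w :
  \sum_b codebook_pmf b * channel_mean (b.2 w)
    (fun s yz => delta s (b.1 (cloud_decoder b yz.2)) yz.2) <=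
  Delta + dmax * (alpha1 + m1%:R * gamma).
Proof.
have [cb0 _] := codebook_pmf_is_pmf.
apply: (@le_trans _ _ (\sum_b (codebook_pmf b * channel_mean (b.2 w)
     (fun s yz => delta s (b.1 (c w)) yz.2) + dmax * (
   codebook_pmf b * channel_mean (b.2 w)
     (fun s yz => (~~ A (b.1 (c w)) yz.2)%:R) +
   \sum_(k | k != c w) codebook_pmf b * channel_mean (b.2 w)
     (fun s yz => (A (b.1 k) yz.2)%:R))))).
  apply: ler_sum => b _; rewrite -mulr_sumr -mulrDr -channel_mean_sum.
  rewrite -channel_meanD mulrCA -[dmax * _]channel_meanZ -mulrDr -channel_meanD.
  apply: ler_wpM2l => //; apply: le_channel_mean => s yz.
  apply: (@le_trans _ _ (delta s (b.1 (c w)) yz.2 +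
    dmax * (cloud_decoder b yz.2 != c w)%:R)).
    case: eqP => [->|_] /=; first by rewrite mulr0 addr0.
    by rewrite mulr1; apply: ler_wpDl.
  by rewrite lerD2l; apply: ler_wpM2l => //; exact: pick_error.
rewrite big_split /= -mulr_sumr big_split /=; apply: lerD.
  by rewrite (codebook_mean1 w (fun u x =>
    channel_mean x (fun s yz => delta s u yz.2))).
apply: ler_wpM2l => //; apply: lerD.
  by rewrite (codebook_mean1 w (fun u x =>
    channel_mean x (fun s yz => (~~ A u yz.2)%:R))).
have g0 : 0 <= gamma.
  apply: le_trans A_other; apply: joint_mean_ge0 => u x s yz.
  by apply: sumr_ge0 => x' _; rewrite mulr_ge0.
rewrite exchange_big /=.
apply: (@le_trans _ _ (\sum_(k | k != c w) gamma)); last first.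
  rewrite sumr_const -[leLHS]mulr_natl; apply: ler_wpM2r => //; rewrite ler_nat.
  by rewrite cardC1 -subn1 leq_subLR add1n.
apply: ler_sum => k kc.
rewrite (codebook_mean_idx (fun u x u' =>
  channel_mean x (fun s yz => (A u' yz.2)%:R))) 1?eq_sym //.
apply: le_trans A_other; rewrite le_eqVlt; apply/orP; left; apply/eqP.
apply: eq_bigr => u _; congr (_ * _); apply: eq_bigr => x _; congr (_ * _).
by rewrite channel_mean_sum; apply: eq_bigr => x' _; rewrite channel_meanZ.
Qed.

(* The weighted sum lets a single averaging argument control error probability
   and distortion simultaneously. *)
Lemma random_coding (a : R) : 0 <= a -> exists b,
  a * (#|Msg|%:R^-1 * \sum_w channel_mean (b.2 w)
         (fun s yz => (threshold_decoder b yz.1 s != w)%:R)) +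
  #|Msg|%:R^-1 * \sum_w channel_mean (b.2 w)
         (fun s yz => delta s (b.1 (cloud_decoder b yz.2)) yz.2) <=
  a * (alpha + m2%:R * beta2 + m3%:R * beta3) +
  (Delta + dmax * (alpha1 + m1%:R * gamma)).
Proof.
move=> a0; apply: (exists_le_mean codebook_pmf_is_pmf).
have M0 : 0 < #|Msg|%:R :> R by rewrite ltr0n; apply/card_gt0P; exists w0.
pose e b w := channel_mean (b.2 w)
  (fun s yz => (threshold_decoder b yz.1 s != w)%:R).
pose f b w := channel_mean (b.2 w)
  (fun s yz => delta s (b.1 (cloud_decoder b yz.2)) yz.2).
set bound := leRHS.
rewrite [leLHS](_ : _ = \sum_(b : {ffun Idx -> U} * {ffun Msg -> X}) \sum_w
    #|Msg|%:R^-1 * (a * (codebook_pmf b * e b w) + codebook_pmf b * f b w)); last first.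
  apply: eq_bigr => b _.
  rewrite -mulr_sumr big_split /= -!mulr_sumr /e /f; ring.
rewrite exchange_big /=.
have -> : bound = \sum_(w : Msg) #|Msg|%:R^-1 * bound.
  rewrite -mulr_sumr sumr_const -[bound *+ _]mulr_natl mulrA mulVf ?mul1r //.
  by rewrite gt_eqF.
apply: ler_sum => w _; rewrite -mulr_sumr; apply: ler_wpM2l.
  by rewrite invr_ge0 ltW.
rewrite big_split /= -mulr_sumr; apply: lerD; last exact: mean_distortion.
by apply: ler_wpM2l => //; exact: mean_decoding_error.
Qed.

End RandomCoding.

(** * Single-letter and block laws *)

Section Divergence.
Variables (R : realType) (T : finType) (p : T -> R).
Hypothesis p_pmf : is_pmf p.

Lemma law_ge0 (V : finType) (f : T -> V) v : 0 <= law p f v.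
Proof. by have [p0 _] := p_pmf; exact: sumr_ge0. Qed.

Lemma le_law (V V' : finType) (f : T -> V) (h : V -> V') v :
  law p f v <= law p (fun t => h (f t)) (h v).
Proof.
rewrite !lawE; apply: ler_sum => t _; apply: ler_wpM2l.
  by case: p_pmf.
by rewrite ler_nat; case: eqP => // ->; rewrite eqxx.
Qed.

Lemma law_eq0 (V V' : finType) (f : T -> V) (h : V -> V') v :
  law p (fun t => h (f t)) (h v) = 0 -> law p f v = 0.
Proof. by move=> h0; apply/eqP; rewrite eq_le law_ge0 andbT -h0 le_law. Qed.

Lemma mutual_infoE (T1 T2 : finType) (A : T -> T1) (B : T -> T2) :
  mutual_info p A B = \sum_v law p (fun t => (A t, B t)) v *
    log2 (law p (fun t => (A t, B t)) v / (law p A v.1 * law p B v.2)).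
Proof.
rewrite /mutual_info pair_bigA; apply: eq_bigr => -[a b] _ //.
Qed.

(** Rewrites conditional mutual information as a divergence from the law in which [A] is redrawn
    from [k] given [C]. Where the law of [C] vanishes [k] is arbitrary, so a genuine coding kernel
    can replace the default value of [cond_law]. *)
Lemma cond_mutual_infoE (T1 T2 T3 : finType) (A : T -> T1) (B : T -> T2)
    (C : T -> T3) (k : T1 -> T3 -> R) :
  (forall a c, law p (fun t => (A t, C t)) (a, c) = law p C c * k a c) ->
  cond_mutual_info p A B C =
  \sum_v law p (fun t => (A t, B t, C t)) v *
    log2 (law p (fun t => (A t, B t, C t)) v /
          (k v.1.1 v.2 * law p (fun t => (B t, C t)) (v.1.2, v.2))).
Proof.
move=> kE; rewrite /cond_mutual_info.
rewrite pair_bigA /= pair_bigA /=; apply: eq_bigr => -[[a b] c] _ /=.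
have [->|P0] := eqVneq (law p (fun t => (A t, B t, C t)) (a, b, c)) 0.
  by rewrite !mul0r.
congr (_ * log2 _); rewrite /cond_law kE.
have C0 : law p C c != 0.
  by apply: contra_neq P0 => h; apply: (law_eq0 (h := snd)).
have BC0 : law p (fun t => (B t, C t)) (b, c) != 0.
  apply: contra_neq P0 => h.
  exact: (law_eq0 (h := fun v : T1 * T2 * T3 => (v.1.2, v.2))).
have k0 : k a c != 0.
  have : law p (fun t => (A t, C t)) (a, c) != 0.
    apply: contra_neq P0 => h.
    exact: (law_eq0 (h := fun v : T1 * T2 * T3 => (v.1.1, v.2))).
  by rewrite kE mulf_eq0 => /norP[].
by field; rewrite C0 BC0 k0.
Qed.

Lemma Expect_law (V : finType) (f : T -> V) (F : V -> R) :
  Expect p (fun t => F (f t)) = \sum_v law p f v * F v.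
Proof. exact: (sum_law p f F). Qed.

End Divergence.

Section SingleLetterLaws.
Variables (R : realType) (U X S Y Z : finType).

Lemma joint_meanE (PU : U -> R) (K : U -> X -> R) (PS : S -> R)
    (W : X -> S -> Y * Z -> R) (G : U -> X -> S -> Y * Z -> R) :
  joint_mean PU K PS W G =
  \sum_o single_letter_pmf (fun ux => PU ux.1 * K ux.1 ux.2) PS W o *
    G o.1.1.1 o.1.1.2 o.1.2 o.2.
Proof.
pose H u x s yz := PU u * K u x * PS s * W x s yz * G u x s yz.
transitivity (\sum_u \sum_x \sum_s \sum_yz H u x s yz).
  apply: eq_bigr => u _; rewrite mulr_sumr; apply: eq_bigr => x _.
  rewrite !mulr_sumr; apply: eq_bigr => s _.
  by rewrite !mulr_sumr; apply: eq_bigr => yz _; rewrite /H; ring.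
rewrite pair_bigA /= pair_bigA /= pair_bigA /=.
by apply: eq_bigr => -[[[u x] s] yz] _.
Qed.

Variables (PU : U -> R) (K : U -> X -> R) (PS : S -> R).
Variable W : X -> S -> Y * Z -> R.
Hypothesis PU_pmf : is_pmf PU.
Hypothesis K_pmf : forall u, is_pmf (K u).
Hypothesis PS_pmf : is_pmf PS.
Hypothesis W_pmf : forall x s, is_pmf (W x s).

Let p := single_letter_pmf (fun ux => PU ux.1 * K ux.1 ux.2) PS W.

Lemma sum_input (F : U -> X -> S -> R) :
  \sum_o p o * F (rvU o) (rvX o) (rvS o) =
  \sum_u PU u * \sum_x K u x * \sum_s PS s * F u x s.
Proof.
rewrite -(joint_meanE PU K PS W (fun u x s _ => F u x s)).
apply: eq_bigr => u _; congr (_ * _); apply: eq_bigr => x _; congr (_ * _).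
apply: eq_bigr => s _; congr (_ * _).
by rewrite -mulr_suml; have [_ ->] := W_pmf x s; rewrite mul1r.
Qed.

Lemma single_letter_is_pmf : is_pmf p.
Proof.
split=> [[[[u x] s] yz]|].
  rewrite /p /=; have [? _] := PU_pmf; have [? _] := K_pmf u.
  by have [? _] := PS_pmf; have [? _] := W_pmf x s; rewrite !mulr_ge0.
under eq_bigr => o _ do rewrite -[p o]mulr1.
rewrite (sum_input (fun _ _ _ => 1)).
have [_ PU1] := PU_pmf; rewrite -[RHS]PU1; apply: eq_bigr => u _.
have [_ K1] := K_pmf u; rewrite -[RHS]mulr1 -K1; congr (_ * _).
apply: eq_bigr => x _.
by rewrite K1 -mulr_suml; have [_ ->] := PS_pmf; rewrite !mulr1.
Qed.

Lemma law_U u : law p rvU u = PU u.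
Proof.
rewrite lawE (sum_input (fun u' _ _ => (u' == u)%:R)).
rewrite -[RHS](sum_pointr u PU); apply: eq_bigr => u' _; congr (_ * _).
under eq_bigr => x _ do rewrite -mulr_suml.
by rewrite -mulr_suml; have [_ ->] := PS_pmf; have [_ ->] := K_pmf u'; rewrite !mul1r.
Qed.

Lemma law_S s : law p rvS s = PS s.
Proof.
rewrite lawE (sum_input (fun _ _ s' => (s' == s)%:R)).
under eq_bigr => u _.
  under eq_bigr => x _ do rewrite sum_pointr.
  rewrite -mulr_suml; have [_ ->] := K_pmf u; rewrite mul1r.
  over.
by rewrite -mulr_suml; have [_ ->] := PU_pmf; rewrite mul1r.
Qed.

Lemma law_US u s : law p (fun o => (rvU o, rvS o)) (u, s) = PU u * PS s.
Proof.
rewrite lawE (sum_input (fun u' _ s' => ((u', s') == (u, s))%:R)).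
rewrite -[RHS](sum_pointr u (fun u => PU u * PS s)); apply: eq_bigr => u' _.
rewrite -mulrA; congr (_ * _); rewrite -mulr_suml.
have [_ ->] := K_pmf u'; rewrite mul1r -(sum_pointr s PS) mulr_suml.
apply: eq_bigr => s' _; rewrite xpair_eqE -mulrA; congr (_ * _).
by case: eqP; case: eqP; rewrite /= ?mulr1 ?mulr0.
Qed.

(** The codeword is drawn without regard to the state, so conditioning on S besides U leaves the
    kernel [K] unchanged. This factorization and [law_XS] supply the [k] of [cond_mutual_infoE]. *)
Lemma law_XUS x u s :
  law p (fun o => (rvX o, (rvU o, rvS o))) (x, (u, s)) =
  law p (fun o => (rvU o, rvS o)) (u, s) * K u x.
Proof.
rewrite law_US lawE.
rewrite (sum_input (fun u' x' s' => ((x', (u', s')) == (x, (u, s)))%:R)).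
rewrite -(sum_pointr u (fun u => PU u * PS s * K u x)).
apply: eq_bigr => u' _; rewrite -!mulrA; congr (_ * _).
transitivity (\sum_x' (K u' x' * (PS s * (u' == u)%:R)) * (x' == x)%:R).
  apply: eq_bigr => x' _; rewrite -!mulrA; congr (_ * _).
  rewrite -(sum_pointr s (fun s => PS s * _)); apply: eq_bigr => s' _.
  rewrite !xpair_eqE -!mulrA; congr (_ * _).
  by case: eqP; case: eqP; case: eqP; rewrite /= ?mulr1 ?mulr0.
by rewrite sum_pointr; ring.
Qed.

Lemma law_XS x s :
  law p (fun o => (rvX o, rvS o)) (x, s) =
  law p rvS s * \sum_u PU u * K u x.
Proof.
rewrite law_S lawE.
rewrite (sum_input (fun _ x' s' => ((x', s') == (x, s))%:R)) mulr_sumr.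
apply: eq_bigr => u _; rewrite mulrCA; congr (_ * _).
transitivity (\sum_x' (K u x' * PS s) * (x' == x)%:R).
  apply: eq_bigr => x' _; rewrite -!mulrA; congr (_ * _).
  rewrite -(sum_pointr s (fun s => PS s * _)); apply: eq_bigr => s' _.
  rewrite !xpair_eqE -!mulrA; congr (_ * _).
  by case: eqP; case: eqP; rewrite /= ?mulr1 ?mulr0.
by rewrite sum_pointr mulrC.
Qed.

End SingleLetterLaws.

(** * Product laws over blocks *)

Section BlockLaws.
Variables (R : realType) (I : finType).

(** Here [t] is the true block and [e] a fresh wrong codeword drawn from it through [k]. Seen by the
    receiver the two form a memoryless block again, so the false-alarm bound of [stein] applies. *)
Lemma prod_ext_law (T E V : finType) (p : T -> R) (k : T -> E -> R)
    (g : T -> E -> V) (F : {ffun I -> V} -> R) :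
  \sum_(t : {ffun I -> T}) \prod_i p (t i) *
    (\sum_(e : {ffun I -> E}) \prod_i k (t i) (e i) *
       F [ffun i => g (t i) (e i)]) =
  \sum_(v : {ffun I -> V}) \prod_i
    law (fun te => p te.1 * k te.1 te.2) (fun te => g te.1 te.2) (v i) * F v.
Proof.
rewrite -prod_law.
transitivity (\sum_(t : {ffun I -> T}) \sum_(e : {ffun I -> E})
    (\prod_i (p (t i) * k (t i) (e i))) * F [ffun i => g (t i) (e i)]).
  apply: eq_bigr => t _; rewrite mulr_sumr; apply: eq_bigr => e _.
  by rewrite big_split mulrA.
rewrite sum_unzip; apply: eq_bigr => t _ /=; congr (_ * F _).
  by apply: eq_bigr => i _; rewrite !ffunE.
by apply/ffunP => i; rewrite !ffunE.
Qed.

Variables (U X S Y Z : finType).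
Variables (PU : U -> R) (K : U -> X -> R) (PS : S -> R).
Variable W : X -> S -> Y * Z -> R.

Definition iid (T : finType) (P : T -> R) (t : {ffun I -> T}) : R :=
  \prod_i P (t i).
Definition memoryless_input (u : {ffun I -> U}) (x : {ffun I -> X}) : R :=
  \prod_i K (u i) (x i).
Definition memoryless (x : {ffun I -> X}) (s : {ffun I -> S})
  (yz : {ffun I -> Y} * {ffun I -> Z}) : R :=
  \prod_i W (x i) (s i) (yz.1 i, yz.2 i).

Lemma iid_is_pmf (T : finType) (P : T -> R) : is_pmf P -> is_pmf (iid P).
Proof.
move=> [P0 P1]; split=> [t|]; first exact: prodr_ge0.
exact: (@sum_ffun_pmf R I T (fun=> P)).
Qed.

Lemma memoryless_input_is_pmf u :
  (forall u, is_pmf (K u)) -> is_pmf (memoryless_input u).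
Proof.
move=> K_pmf; split=> [x|].
  by apply: prodr_ge0 => i _; have [] := K_pmf (u i).
apply: (@sum_ffun_pmf R I X (fun i => K (u i))) => i.
by have [] := K_pmf (u i).
Qed.

Lemma memoryless_is_pmf x s :
  (forall x s, is_pmf (W x s)) -> is_pmf (memoryless x s).
Proof.
move=> W_pmf; split=> [yz|].
  by apply: prodr_ge0 => i _; have [] := W_pmf (x i) (s i).
transitivity (\sum_(t : {ffun I -> Y * Z}) \prod_i W (x i) (s i) (t i)).
  rewrite -(pair_bigA _ (fun y z => memoryless x s (y, z))) sum_unzip.
  apply: eq_bigr => t _; apply: eq_bigr => i _ /=.
  by rewrite !ffunE -surjective_pairing.
apply: (@sum_ffun_pmf R I (Y * Z)%type (fun i => W (x i) (s i))) => i.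
by have [] := W_pmf (x i) (s i).
Qed.

(** Bridge between the one-shot argument and the single-letter law: a tuple of blocks is transposed
    into a block of tuples. *)
Lemma block_joint_meanE
    (G : {ffun I -> U} -> {ffun I -> X} -> {ffun I -> S} ->
         {ffun I -> Y} * {ffun I -> Z} -> R) :
  joint_mean (iid PU) memoryless_input (iid PS) memoryless G =
  \sum_(t : {ffun I -> U * X * S * (Y * Z)})
    \prod_i single_letter_pmf (fun ux => PU ux.1 * K ux.1 ux.2) PS W (t i) *
    G [ffun i => rvU (t i)] [ffun i => rvX (t i)] [ffun i => rvS (t i)]
      ([ffun i => rvY (t i)], [ffun i => rvZ (t i)]).
Proof.
rewrite joint_meanE.
rewrite (reindex (fun t : {ffun I -> U * X * S * (Y * Z)} =>
  ([ffun i => rvU (t i)] : {ffun I -> U}, [ffun i => rvX (t i)] : {ffun I -> X},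
   [ffun i => rvS (t i)] : {ffun I -> S},
   ([ffun i => rvY (t i)] : {ffun I -> Y},
    [ffun i => rvZ (t i)] : {ffun I -> Z})))) /=; last first.
  exists (fun o : {ffun I -> U} * {ffun I -> X} * {ffun I -> S} *
      ({ffun I -> Y} * {ffun I -> Z}) => [ffun i =>
      (o.1.1.1 i, o.1.1.2 i, o.1.2 i, (o.2.1 i, o.2.2 i))])
    => /= [t _|[[[u x] s] [y z]] _].
    by apply/ffunP => i; rewrite !ffunE; case: (t i) => -[[? ?] ?] [? ?].
  by congr (_, _, _, (_, _)); apply/ffunP => i; rewrite !ffunE.
apply: eq_bigr => t _; congr (_ * _).
rewrite /iid /memoryless_input /memoryless -!big_split /=.
apply: eq_bigr => i _; rewrite !ffunE.
by case: (t i) => -[[u x] s] [y z].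
Qed.

End BlockLaws.

(** * Performance of superposition codes *)

Section NumMessages.
Variable R : realType.

Lemma num_messagesE (r : R) n :
  (num_messages r n)%:R = (Num.ceil (2 `^ (n%:R * r) : R))%:~R :> R.
Proof.
rewrite /num_messages natr_absz ger0_norm //.
by rewrite ceil_ge0 (lt_le_trans _ (powR_ge0 _ _)) // oppr_lt0.
Qed.

Lemma num_messages_gt0 (r : R) n : (0 < num_messages r n)%N.
Proof.
by rewrite -(ltr0n R) num_messagesE ltr0z ceil_gt0 powR_gt0.
Qed.

(* The bound is also meaningful for [r < 0], where there is one message. *)
Lemma num_messages_pred (r : R) n :
  (num_messages r n).-1%:R <= 2 `^ (n%:R * r) :> R.
Proof.
rewrite -subn1 natrB ?num_messages_gt0 // num_messagesE.
by have := ceilB1_lt (2 `^ (n%:R * r) : R); rewrite intrB => /ltW.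
Qed.

Lemma num_messagesD (r r1 r2 : R) n : r <= r1 + r2 ->
  (num_messages r n <= num_messages r1 n * num_messages r2 n)%N.
Proof.
move=> rr; rewrite -(ler_nat R) natrM [leLHS]num_messagesE.
have : 2 `^ (n%:R * r) <= ((num_messages r1 n * num_messages r2 n)%N : int)%:~R :> R.
  rewrite -pmulrn natrM.
  apply: (@le_trans _ _ (2 `^ (n%:R * r1) * 2 `^ (n%:R * r2))).
    rewrite -powRD ?implybT ?pnatr_eq0 // ?implybT //.
    by apply: ler_powR; rewrite ?ler1n // -mulrDr ler_wpM2l.
  by apply: ler_pM; rewrite ?powR_ge0 // num_messagesE ceil_ge.
by rewrite -ceil_le_int -(ler_int R) -pmulrn natrM.
Qed.

Lemma expn_powR (r : R) n : 2 `^ (n%:R * r) = (2 `^ r) ^+ n :> R.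
Proof. by rewrite mulrC powRrM powR_mulrn // powR_ge0. Qed.

(** Number of wrong candidates times the false-alarm probability of one test: it decays
    geometrically as soon as the rate [r] is below the threshold [r']. *)
Lemma num_messages_test (r r' : R) n (x : R) : x <= 2 `^ (- (n%:R * r')) ->
  (num_messages r n).-1%:R * x <= (2 `^ (r - r')) ^+ n.
Proof.
move=> xr; apply: (@le_trans _ _ ((num_messages r n).-1%:R * 2 `^ (- (n%:R * r')))).
  exact: ler_wpM2l.
rewrite -expn_powR mulrBr powRB ?pnatr_eq0 ?implybT //.
by rewrite powRN; apply: ler_wpM2r; rewrite ?invr_ge0 ?powR_ge0 ?num_messages_pred.
Qed.

End NumMessages.

Section CloudIndex.

(** A cloud is a run of [M2] consecutive messages: the quotient by [M2] names the cloud, and the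
    remainder then determines the message. The predecessor of [M2] appears because [w] itself is not
    counted. *)
Lemma cloud_index_exists (M M1 M2 : nat) :
  (0 < M2)%N -> (M <= M1 * M2)%N ->
  exists c : 'I_M -> 'I_M1, forall w,
    (#|[pred w' | (w' != w) && (c w' == c w)]| <= M2.-1)%N.
Proof.
move=> M2_gt0 MM.
have lt (w : 'I_M) : (w %/ M2 < M1)%N.
  by rewrite ltn_divLR // (leq_trans (ltn_ord w)).
exists (fun w => Ordinal (lt w)) => w.
set c := fun w => Ordinal (lt w).
have lt2 (w' : 'I_M) : (w' %% M2 < M2)%N by rewrite ltn_mod.
pose A := [pred w' | c w' == c w].
have : (#|A| <= M2)%N.
  rewrite -[M2 in leqRHS]card_ord.
  rewrite -(@card_in_image _ _ (fun w' => Ordinal (lt2 w')) A) ?max_card //.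
  move=> w1 w2; rewrite !inE => /eqP e1 /eqP e2 [e].
  apply: val_inj; rewrite /= (divn_eq w1 M2) (divn_eq w2 M2) e.
  by have := congr1 val (etrans e1 (esym e2)) => /= ->.
rewrite (cardD1 w) inE eqxx add1n => h.
rewrite -ltnS prednK //; apply: leq_trans h; rewrite ltnS.
Qed.

End CloudIndex.

Section CodePerformance.
Variables (R : realType) (X S Y Z Shat : finType).
Variables (PS : S -> R) (W : X -> S -> Y * Z -> R).
Variables (n M : nat) (c : isac_code X S Y Z Shat n M).

Lemma Expect_code (F : 'I_M * {ffun 'I_n -> S} *
    ({ffun 'I_n -> Y} * {ffun 'I_n -> Z}) -> R) :
  Expect (code_pmf PS W c) F = M%:R^-1 * \sum_w
    channel_mean (iid PS) (memoryless W) (encoder c w)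
      (fun s yz => F (w, s, yz)).
Proof.
transitivity (\sum_w \sum_s \sum_yz
    code_pmf PS W c (w, s, yz) * F (w, s, yz)).
  by rewrite pair_bigA /= pair_bigA /=; apply: eq_bigr => -[[w s] yz] _.
rewrite mulr_sumr; apply: eq_bigr => w _; rewrite mulr_sumr.
apply: eq_bigr => s _; rewrite !mulr_sumr; apply: eq_bigr => -[y z] _.
by rewrite /iid /memoryless /=; ring.
Qed.

Lemma error_probE : error_prob PS W c = M%:R^-1 * \sum_w
  channel_mean (iid PS) (memoryless W) (encoder c w)
    (fun s yz => (decoder c yz.1 s != w)%:R).
Proof.
transitivity (Expect (code_pmf PS W c)
  (fun o => (decoder c o.2.1 o.1.2 != o.1.1)%:R)); last by rewrite Expect_code.
rewrite /error_prob /Prob big_mkcond; apply: eq_bigr => -[[w s] [y z]] _ /=.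
by case: (_ != _); rewrite ?mulr1 ?mulr0.
Qed.

Lemma distortionE (d : S -> Shat -> R) : distortion PS W d c =
  M%:R^-1 * \sum_w
  channel_mean (iid PS) (memoryless W) (encoder c w)
    (fun s yz => n%:R^-1 * \sum_i d (s i) (estimator c yz.2 i)).
Proof.
transitivity (n%:R^-1 * Expect (code_pmf PS W c)
    (fun o => \sum_i d (o.1.2 i) (estimator c o.2.2 i))).
  congr (_ * _); rewrite exchange_big /=; apply: eq_bigr => -[[w s] [y z]] _ /=.
  by rewrite mulr_sumr.
rewrite Expect_code mulrCA mulr_sumr; congr (_ * _).
by apply: eq_bigr => w _; rewrite channel_meanZ.
Qed.

End CodePerformance.

(** In the application [a] is the error probability divided by [k = kappa ^+ n], [b] the distortion
    and [m] a bound on [d]. Boundedness of [a] is thus geometric decay of the error. The constants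
    have slack so that one constant serves this bound and the next. *)
Lemma superposition_error_bound (R : realType) (a b m k D : R) :
  a + b <= 4 * k + D + 2 * m * k -> 0 <= b -> m * k <= m -> 0 <= m -> k <= 1 ->
  a <= D + 6 + 6 * m.
Proof. lra. Qed.

Lemma superposition_distortion_bound (R : realType) (a b m k D : R) :
  a + b <= 4 * k + D + 2 * m * k -> 0 <= a -> 0 <= D -> 0 <= m -> 0 <= k ->
  b <= D + (D + 6 + 6 * m) * k.
Proof.
move=> h a0 D0 m0 k0.
have := mulr_ge0 D0 k0; have := mulr_ge0 m0 k0; lra.
Qed.

(** * The three tests and the code built from them *)

Section SuperpositionCode.
Variables (R : realType) (U X S Y Z Shat : finType).
Variables (PU : U -> R) (K : U -> X -> R) (PS : S -> R).
Variable W : X -> S -> Y * Z -> R.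
Hypothesis PU_pmf : is_pmf PU.
Hypothesis K_pmf : forall u, is_pmf (K u).
Hypothesis PS_pmf : is_pmf PS.
Hypothesis W_pmf : forall x s, is_pmf (W x s).

Let p := single_letter_pmf (fun ux => PU ux.1 * K ux.1 ux.2) PS W.
Let p_pmf : is_pmf p. Proof. exact: single_letter_is_pmf. Qed.
Let PX x := \sum_u PU u * K u x.

Let p0 o : 0 <= p o. Proof. by case: p_pmf. Qed.
Let PU0 u : 0 <= PU u. Proof. by case: PU_pmf. Qed.
Let K0 u x : 0 <= K u x. Proof. by case: (K_pmf u). Qed.

Let mean n := joint_mean (@iid R 'I_n U PU) (@memoryless_input R 'I_n U X K)
  (@iid R 'I_n S PS) (@memoryless R 'I_n X S Y Z W).

(** Pattern of all three tests: [P] is absolutely continuous with respect to [Q],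
    [block_joint_meanE] with [prod_law] turns the miss mean into a product of [P], [prod_ext_law]
    turns the false-alarm mean into a product of [Q], and [stein] bounds both. Here a fresh centre
    is independent of the sensing output. *)
Lemma cloud_test (r : R) : r < mutual_info p rvU rvZ ->
  exists2 rho : R, 0 <= rho < 1 & forall n,
  exists A : {ffun 'I_n -> U} -> {ffun 'I_n -> Z} -> bool,
    mean (fun u x s yz => (~~ A u yz.2)%:R) <= rho ^+ n /\
    mean (fun u x s yz => \sum_u' iid PU u' * (A u' yz.2)%:R) <=
      2 `^ (- (n%:R * r)).
Proof.
rewrite mutual_infoE => rI.
pose P := law p (fun o => (rvU o, rvZ o)).
pose Q v := law p rvU v.1 * law p rvZ v.2.
have P_pmf : is_pmf P by exact: pmf_law.
have Q0 v : 0 <= Q v by rewrite mulr_ge0 // law_ge0.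
have PQ v : Q v = 0 -> P v = 0.
  case: v => u z /eqP; rewrite mulf_eq0 => /orP[] /eqP h.
    exact: (law_eq0 p_pmf (h := fst)).
  exact: (law_eq0 p_pmf (h := snd)).
have [rho rho01 h] := stein P_pmf Q0 PQ rI.
exists rho => // n; have [A [hP hQ]] := h n.
exists (fun u z => A [ffun i => (u i, z i)]); split.
  apply: le_trans hP; rewrite /mean block_joint_meanE /P.
  rewrite -(prod_law p (fun o => (rvU o, rvZ o)) (fun v => (~~ A v)%:R)).
  rewrite le_eqVlt; apply/orP; left; apply/eqP; apply: eq_bigr => t _.
  congr (_ * (~~ A _)%:R); by apply/ffunP => i; rewrite !ffunE.
apply: le_trans hQ; rewrite /mean block_joint_meanE.
have -> : Q = law (fun te => p te.1 * PU te.2) (fun te => (te.2, rvZ te.1)).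
  apply/funext => -[u z]; rewrite lawE /Q /= law_U // lawE mulr_sumr.
  rewrite -(pair_bigA _ (fun t e => p t * PU e * ((e, rvZ t) == (u, z))%:R)) /=.
  apply: eq_bigr => t _; rewrite -(sum_pointr u PU) mulr_suml.
  by apply: eq_bigr => u' _; rewrite xpair_eqE -mulnb natrM; ring.
rewrite -(prod_ext_law p (fun _ => PU) (fun t u => (u, rvZ t))
  (fun v => (A v)%:R)).
rewrite le_eqVlt; apply/orP; left; apply/eqP; apply: eq_bigr => t _.
congr (_ * _); apply: eq_bigr => u _; congr (_ * (A _)%:R).
by apply/ffunP => i; rewrite !ffunE.
Qed.

(** The wrong satellite shares the true centre, so [Q] keeps the true law of (Y, U, S) and redraws
    only X from [K]. *)
Lemma satellite_test (r : R) :
  r < cond_mutual_info p rvX rvY (fun o => (rvU o, rvS o)) ->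
  exists2 rho : R, 0 <= rho < 1 & forall n,
  exists A : {ffun 'I_n -> U} -> {ffun 'I_n -> X} -> {ffun 'I_n -> S} ->
      {ffun 'I_n -> Y} -> bool,
    mean (fun u x s yz => (~~ A u x s yz.1)%:R) <= rho ^+ n /\
    mean (fun u x s yz =>
        \sum_x' memoryless_input K u x' * (A u x' s yz.1)%:R) <=
      2 `^ (- (n%:R * r)).
Proof.
rewrite (cond_mutual_infoE p_pmf rvY (k := fun x us => K us.1 x)); last first.
  by move=> x [u s]; exact: law_XUS.
pose P := law p (fun o => (rvX o, rvY o, (rvU o, rvS o))).
pose Q v := K v.2.1 v.1.1 * law p (fun o => (rvY o, (rvU o, rvS o))) (v.1.2, v.2).
move=> rI.
have P_pmf : is_pmf P by exact: pmf_law.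
have Q0 v : 0 <= Q v by rewrite mulr_ge0 // law_ge0.
have PQ v : Q v = 0 -> P v = 0.
  case: v => -[x y] [u s] /eqP; rewrite mulf_eq0 => /orP[] /eqP /= h.
    apply: (law_eq0 p_pmf (h := fun v => (v.1.1, v.2))) => /=.
    by rewrite law_XUS // h mulr0.
  exact: (law_eq0 p_pmf (h := fun v => (v.1.2, v.2))).
have [rho rho01 h] := stein P_pmf Q0 PQ rI.
exists rho => // n; have [A [hP hQ]] := h n.
exists (fun u x s y => A [ffun i => (x i, y i, (u i, s i))]); split.
  apply: le_trans hP; rewrite /mean block_joint_meanE /P.
  rewrite -(prod_law p (fun o => (rvX o, rvY o, (rvU o, rvS o)))
    (fun v => (~~ A v)%:R)).
  rewrite le_eqVlt; apply/orP; left; apply/eqP; apply: eq_bigr => t _.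
  congr (_ * (~~ A _)%:R); by apply/ffunP => i; rewrite !ffunE.
apply: le_trans hQ; rewrite /mean block_joint_meanE.
have -> : Q = law (fun te => p te.1 * K (rvU te.1) te.2)
    (fun te => (te.2, rvY te.1, (rvU te.1, rvS te.1))).
  apply/funext => -[[x y] [u s]]; rewrite lawE /Q /= lawE mulr_sumr.
  rewrite -(pair_bigA _ (fun t e => p t * K (rvU t) e *
    ((e, rvY t, (rvU t, rvS t)) == (x, y, (u, s)))%:R)) /=.
  apply: eq_bigr => t _; transitivity (\sum_e
      (p t * K (rvU t) e * ((rvY t, (rvU t, rvS t)) == (y, (u, s)))%:R)
      * (e == x)%:R); last first.
    by apply: eq_bigr => e _; rewrite !xpair_eqE -!mulnb !natrM; ring.
  rewrite sum_pointr; case: eqP => [[_ -> _]|_]; last by rewrite !mulr0.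
  by rewrite !mulr1 mulrC.
rewrite -(prod_ext_law p (fun t => K (rvU t))
  (fun t x => (x, rvY t, (rvU t, rvS t))) (fun v => (A v)%:R)).
rewrite le_eqVlt; apply/orP; left; apply/eqP; apply: eq_bigr => t _.
congr (_ * _); apply: eq_bigr => x _; congr (_ * (A _)%:R).
  by apply: eq_bigr => i _; rewrite ffunE.
by apply/ffunP => i; rewrite !ffunE.
Qed.

(** The test ignores the centre: a fresh pair (u', x') enters only through its satellite, whose law
    is [PX], and the divergence is then the conditional information between X and Y given S. *)
Lemma joint_test (r : R) : r < cond_mutual_info p rvX rvY rvS ->
  exists2 rho : R, 0 <= rho < 1 & forall n,
  exists A : {ffun 'I_n -> X} -> {ffun 'I_n -> S} -> {ffun 'I_n -> Y} -> bool,
    mean (fun u x s yz => (~~ A x s yz.1)%:R) <= rho ^+ n /\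
    mean (fun u x s yz => \sum_u' iid PU u' *
        \sum_x' memoryless_input K u' x' * (A x' s yz.1)%:R) <=
      2 `^ (- (n%:R * r)).
Proof.
rewrite (cond_mutual_infoE p_pmf rvY (k := fun x _ => PX x)); last first.
  by move=> x s; exact: law_XS.
pose P := law p (fun o => (rvX o, rvY o, rvS o)).
pose Q v := PX v.1.1 * law p (fun o => (rvY o, rvS o)) (v.1.2, v.2).
move=> rI.
have P_pmf : is_pmf P by exact: pmf_law.
have Q0 v : 0 <= Q v.
  by rewrite mulr_ge0 ?law_ge0 // sumr_ge0 // => u _; rewrite mulr_ge0.
have PQ v : Q v = 0 -> P v = 0.
  case: v => -[x y] s /eqP; rewrite mulf_eq0 => /orP[] /eqP /= h.
    apply: (law_eq0 p_pmf (h := fun v => (v.1.1, v.2))) => /=.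
    by rewrite law_XS // -/(PX x) h mulr0.
  exact: (law_eq0 p_pmf (h := fun v => (v.1.2, v.2))).
have [rho rho01 h] := stein P_pmf Q0 PQ rI.
exists rho => // n; have [A [hP hQ]] := h n.
exists (fun x s y => A [ffun i => (x i, y i, s i)]); split.
  apply: le_trans hP; rewrite /mean block_joint_meanE /P.
  rewrite -(prod_law p (fun o => (rvX o, rvY o, rvS o)) (fun v => (~~ A v)%:R)).
  rewrite le_eqVlt; apply/orP; left; apply/eqP; apply: eq_bigr => t _.
  congr (_ * (~~ A _)%:R); by apply/ffunP => i; rewrite !ffunE.
apply: le_trans hQ; rewrite /mean block_joint_meanE.
have -> : Q = law (fun te => p te.1 * (PU te.2.1 * K te.2.1 te.2.2))
    (fun te => (te.2.2, rvY te.1, rvS te.1)).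
  apply/funext => -[[x y] s]; rewrite lawE /Q /= lawE mulr_sumr.
  rewrite -(pair_bigA _ (fun t e => p t * (PU e.1 * K e.1 e.2) *
    ((e.2, rvY t, rvS t) == (x, y, s))%:R)) /=.
  apply: eq_bigr => t _.
  rewrite -(pair_bigA _ (fun u x' => p t * (PU u * K u x') *
    ((x', rvY t, rvS t) == (x, y, s))%:R)) /= /PX mulr_suml.
  apply: eq_bigr => u _; rewrite -(sum_pointr x (K u)) mulr_sumr mulr_suml.
  by apply: eq_bigr => e _; rewrite !xpair_eqE -!mulnb !natrM; ring.
rewrite -(prod_ext_law p (fun _ e => PU e.1 * K e.1 e.2)
  (fun t e => (e.2, rvY t, rvS t)) (fun v => (A v)%:R)).
rewrite le_eqVlt; apply/orP; left; apply/eqP; apply: eq_bigr => t _.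
congr (_ * _).
under eq_bigr => u _ do rewrite mulr_sumr.
rewrite sum_unzip; apply: eq_bigr => e _; rewrite mulrA; congr (_ * (A _)%:R).
  by rewrite /iid /memoryless_input -big_split; apply: eq_bigr => i _; rewrite /= !ffunE.
by apply/ffunP => i; rewrite !ffunE.
Qed.

Variables (d : S -> Shat -> R) (shat : U -> Z -> Shat) (D : R).
Hypothesis d_ge0 : forall s s', 0 <= d s s'.
Hypothesis shat_le :
  Expect p (fun o => d (rvS o) (shat (rvU o) (rvZ o))) <= D.

Let D_ge0 : 0 <= D.
Proof. by apply: le_trans shat_le; apply: sumr_ge0 => o _; rewrite mulr_ge0. Qed.

Let dmax := \sum_s \sum_s' d s s'.

Let d_le s s' : d s s' <= dmax.
Proof.
rewrite /dmax (bigD1 s) //= (bigD1 s') //= -addrA lerDl addr_ge0 //.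
  exact: sumr_ge0.
by apply: sumr_ge0 => s1 _; apply: sumr_ge0.
Qed.

Let dmax_ge0 : 0 <= dmax.
Proof. by apply: sumr_ge0 => s _; apply: sumr_ge0. Qed.

Let block_distortion n (s : {ffun 'I_n -> S}) (u : {ffun 'I_n -> U})
  (z : {ffun 'I_n -> Z}) : R := n%:R^-1 * \sum_i d (s i) (shat (u i) (z i)).

Let mean_block_distortion n :
  mean (fun u x s yz => @block_distortion n s u yz.2) <= D.
Proof.
rewrite /mean block_joint_meanE.
rewrite [leLHS](_ : _ = n%:R^-1 * \sum_(i < n)
    \sum_(t : {ffun 'I_n -> U * X * S * (Y * Z)}) \prod_l p (t l) *
      d (rvS (t i)) (shat (rvU (t i)) (rvZ (t i)))); last first.
  rewrite exchange_big mulr_sumr.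
  apply: eq_bigr => t _; rewrite /block_distortion mulrCA mulr_sumr.
  by congr (_ * _); apply: eq_bigr => i _; rewrite !ffunE.
(* For the empty block the left side is 0, and the claim is [D_ge0]. *)
case: n => [|n]; first by rewrite big_ord0 mulr0.
rewrite ler_pdivrMl ?ltr0n // mulr_natl -[n.+1 in leRHS]card_ord -sumr_const.
apply: ler_sum => i _.
rewrite (@marginal1 R 'I_n.+1 _ (fun=> p) i
  (fun o => d (rvS o) (shat (rvU o) (rvZ o)))) //.
by move=> _; case: p_pmf.
Qed.

Lemma superposition_codes (r : R) :
  r < mutual_info p rvU rvZ +
      cond_mutual_info p rvX rvY (fun o => (rvU o, rvS o)) ->
  r < cond_mutual_info p rvX rvY rvS ->
  exists kappa C : R, 0 < kappa < 1 /\ forall n,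
  exists c : isac_code X S Y Z Shat n (num_messages r n),
    error_prob PS W c <= C * kappa ^+ n /\
    distortion PS W d c <= D + C * kappa ^+ n.
Proof.
set I1 := mutual_info _ _ _; set I2 := cond_mutual_info _ _ _ _ => r12 r3.
set I3 := cond_mutual_info _ _ _ _ in r3.
(* A quarter of the gap: with [r1] and [r2] below, [r1 + r2] is exactly [r], and each threshold
   [I1 - e], [I2 - e] lies strictly between the rate and the information. A negative [r1] or [r2] is
   allowed and gives one cloud, or one satellite per cloud. *)
pose e := (I1 + I2 - r) / 4; have e0 : 0 < e by rewrite /e; lra.
have [lt1 lt2 lt3] : [/\ I1 - e < I1, I2 - e < I2 & (r + I3) / 2 < I3].
  by split; lra.
have [rho1 /andP[rho10 rho11] test1] := @cloud_test (I1 - e) lt1.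
have [rho2 /andP[rho20 rho21] test2] := @satellite_test (I2 - e) lt2.
have [rho3 /andP[rho30 rho31] test3] := @joint_test ((r + I3) / 2) lt3.
pose r1 := I1 - 2 * e; pose r2 := I2 - 2 * e.
have rr : r <= r1 + r2 by rewrite /r1 /r2 /e; lra.
have q_lt1 (x : R) : x < 0 -> 2 `^ x < 1.
  move=> x0; rewrite /powR pnatr_eq0 /= expR_lt1 pmulr_llt0 //.
  by rewrite ln_gt0 // ltr1n.
pose q1 : R := 2 `^ (r1 - (I1 - e)); pose q2 : R := 2 `^ (r2 - (I2 - e)).
pose q3 : R := 2 `^ (r - (r + I3) / 2).
have q11 : q1 < 1 by apply: q_lt1; rewrite /r1; lra.
have q21 : q2 < 1 by apply: q_lt1; rewrite /r2; lra.
have q31 : q3 < 1 by apply: q_lt1; lra.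
pose xs := [:: rho1, rho2, rho3, q1, q2 & [:: q3]].
pose theta := \big[Num.max/0]_(y <- xs) y.
have x0 : 0 <= theta by rewrite /theta /xs big_cons le_max rho10.
have x1 : theta < 1.
  by rewrite /theta /xs unlock /= !gt_max rho11 rho21 rho31 q11 q21 q31 ltr01.
(* The difference [kappa ^+ 2 - theta] is the square of [(1 - theta) / 2], so each of the six error
   terms is at most [(kappa ^+ 2) ^+ n]. One factor [kappa ^+ n] will pay for the weight on the
   error probability; the other remains as decay. *)
pose kappa := (1 + theta) / 2.
have kappa_gt0 : 0 < kappa by rewrite /kappa; lra.
have kappa_lt1 : kappa < 1 by rewrite /kappa; lra.
have xk : theta <= kappa ^+ 2.
  by rewrite /kappa expr2; have := sqr_ge0 (1 - theta); rewrite expr2; lra.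
have pk y n : 0 <= y -> y <= theta -> y ^+ n <= (kappa ^+ 2) ^+ n.
  move=> y0 ytheta; apply: lerXn2r; rewrite ?nnegrE ?(le_trans ytheta) //.
  by rewrite ltW ?exprn_gt0.
have [h1 h2 h3 [g1 g2 g3]] : [/\ rho1 <= theta, rho2 <= theta, rho3 <= theta &
    [/\ q1 <= theta, q2 <= theta & q3 <= theta]].
  by rewrite /theta /xs unlock /= !le_max !lexx ?orbT; split.
exists kappa, (D + 6 + 6 * dmax); split; first by rewrite kappa_gt0.
move=> n.
have [A1 [A1P A1Q]] := test1 n.
have [A2 [A2P A2Q]] := test2 n.
have [A3 [A3P A3Q]] := test3 n.
pose M := num_messages r n; pose M1 := num_messages r1 n.
pose M2 := num_messages r2 n.
have [cl clP] := @cloud_index_exists M M1 M2 (num_messages_gt0 _ _)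
  (num_messagesD _ rr).
have PUn := iid_is_pmf 'I_n PU_pmf; have PSn := iid_is_pmf 'I_n PS_pmf.
have Kn (u : {ffun 'I_n -> U}) := memoryless_input_is_pmf u K_pmf.
have Wn (x : {ffun 'I_n -> X}) (s : {ffun 'I_n -> S}) :=
  memoryless_is_pmf x s W_pmf.
(* The conjunction inherits both false-alarm bounds, [A2] against the same cloud and [A3] against
   other clouds, while the miss probabilities add. *)
pose B u x s y := A2 u x s y && A3 x s y.
pose w0 : 'I_M := Ordinal (num_messages_gt0 r n).
pose cloud0 : 'I_M1 := Ordinal (num_messages_gt0 r1 n).
have Bmiss : joint_mean (iid PU) (memoryless_input K) (iid PS) (memoryless W)
    (fun u x s yz => (~~ B u x s yz.1)%:R) <= rho2 ^+ n + rho3 ^+ n.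
  apply: le_trans (lerD A2P A3P); rewrite /mean -joint_meanD.
  apply: (le_joint_mean PUn Kn PSn Wn) => u x s yz.
  by rewrite /B; case: (A2 _ _ _ _); case: (A3 _ _ _); rewrite /= ?addr0 ?add0r ?lerDl.
have Bsame : joint_mean (iid PU) (memoryless_input K) (iid PS) (memoryless W)
    (fun u x s yz => \sum_x' memoryless_input K u x' * (B u x' s yz.1)%:R) <=
    2 `^ (- (n%:R * (I2 - e))).
  apply: le_trans A2Q; apply: (le_joint_mean PUn Kn PSn Wn) => u x s yz.
  apply: ler_sum => x' _; apply: ler_wpM2l; first by case: (Kn u).
  by rewrite /B ler_nat; case: (A2 _ _ _ _) => //=; exact: leq_b1.
have Bother : joint_mean (iid PU) (memoryless_input K) (iid PS) (memoryless W)
    (fun u x s yz => \sum_u' iid PU u' *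
      \sum_x' memoryless_input K u' x' * (B u' x' s yz.1)%:R) <=
    2 `^ (- (n%:R * ((r + I3) / 2))).
  apply: le_trans A3Q; apply: (le_joint_mean PUn Kn PSn Wn) => u x s yz.
  apply: ler_sum => u' _; apply: ler_wpM2l; first by case: PUn.
  apply: ler_sum => x' _; apply: ler_wpM2l; first by case: (Kn u').
  by rewrite /B ler_nat; case: (A2 _ _ _ _).
have bd_ge0 s u z : 0 <= @block_distortion n s u z.
  by rewrite mulr_ge0 // sumr_ge0.
have bd_le s u z : @block_distortion n s u z <= dmax.
  rewrite /block_distortion; case: (n) s u z => [|m] s u z.
    by rewrite big_ord0 mulr0.
  rewrite ler_pdivrMl ?ltr0n // mulr_natl -[m.+1 in leRHS]card_ord -sumr_const.
  exact: ler_sum.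
have cardI m : (0 < m)%N -> (#|'I_m| <= m.-1.+1)%N.
  by move=> m0; rewrite card_ord prednK.
(* The inverse of [k] is the weight given to the error probability in [random_coding]. *)
set k := kappa ^+ n.
have kp : 0 < k by rewrite exprn_gt0.
have k_le1 : k <= 1 by rewrite exprn_ile1 // ltW.
have kV_ge0 : 0 <= k^-1 by rewrite invr_ge0 ltW.
have [b] := random_coding PUn Kn PSn Wn w0 cloud0 Bmiss Bsame Bother A1P A1Q
  (cardI _ (num_messages_gt0 r1 n)) clP (cardI _ (num_messages_gt0 r n))
  bd_ge0 bd_le dmax_ge0 (mean_block_distortion n) kV_ge0.
pose c := IsacCode (fun w => b.2 w)
  (fun y s => threshold_decoder cl B w0 b y s)
  (fun z => [ffun i => shat (b.1 (cloud_decoder A1 cloud0 b z) i) (z i)]).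
have err_ge0 : 0 <= error_prob PS W c.
  rewrite error_probE mulr_ge0 // sumr_ge0 // => w _.
  by apply: (channel_mean_ge0 PSn Wn).
have dist_ge0 : 0 <= distortion PS W d c.
  rewrite distortionE mulr_ge0 // sumr_ge0 // => w _.
  by apply: (channel_mean_ge0 PSn Wn) => s yz; rewrite mulr_ge0 // sumr_ge0.
have -> : #|'I_M|%:R^-1 * (\sum_w channel_mean (iid PS) (memoryless W) (b.2 w)
    (fun s yz => (threshold_decoder cl B w0 b yz.1 s != w)%:R)) =
    error_prob PS W c by rewrite error_probE card_ord.
have -> : #|'I_M|%:R^-1 * (\sum_w channel_mean (iid PS) (memoryless W) (b.2 w)
    (fun s yz => block_distortion s (b.1 (cloud_decoder A1 cloud0 b yz.2)) yz.2)) =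
    distortion PS W d c.
  rewrite distortionE card_ord; congr (_ * _); apply: eq_bigr => w _.
  congr (channel_mean _ _ _ _); apply/funext => s; apply/funext => yz.
  by congr (_ * _); apply: eq_bigr => i _; rewrite ffunE.
move=> hb; exists c.
have kk : (kappa ^+ 2) ^+ n = k * k by rewrite exprAC expr2.
have t1 := pk _ n rho10 h1; have t2 := pk _ n rho20 h2.
have t3 := pk _ n rho30 h3.
have t4 : M1.-1%:R * 2 `^ (- (n%:R * (I1 - e))) <= (kappa ^+ 2) ^+ n.
  exact: le_trans (num_messages_test _ (lexx _)) (pk _ n (powR_ge0 _ _) g1).
have t5 : M2.-1%:R * 2 `^ (- (n%:R * (I2 - e))) <= (kappa ^+ 2) ^+ n.
  exact: le_trans (num_messages_test _ (lexx _)) (pk _ n (powR_ge0 _ _) g2).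
have t6 : M.-1%:R * 2 `^ (- (n%:R * ((r + I3) / 2))) <= (kappa ^+ 2) ^+ n.
  exact: le_trans (num_messages_test _ (lexx _)) (pk _ n (powR_ge0 _ _) g3).
(* Two misses and two union bounds, each at most [k * k], give [4 * k] after weighting. A miss and a
   union bound for the cloud contribute twice [dmax * (k * k)], relaxed to [2 * dmax * k]. *)
have {}hb : k^-1 * error_prob PS W c + distortion PS W d c <=
    4 * k + D + 2 * dmax * k.
  apply: le_trans hb _.
  apply: (@le_trans _ _ (k^-1 * (4 * (k * k)) + (D + dmax * (2 * (k * k))))).
    rewrite -kk.
    apply: lerD; [apply: ler_wpM2l => // | rewrite lerD2l; apply: ler_wpM2l => //].
      apply: le_trans (lerD (lerD (lerD t2 t3) t5) t6) _.
      by rewrite le_eqVlt; apply/orP; left; apply/eqP; ring.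
    apply: le_trans (lerD t1 t4) _.
    by rewrite le_eqVlt; apply/orP; left; apply/eqP; ring.
  have -> : k^-1 * (4 * (k * k)) = 4 * k by field; rewrite gt_eqF.
  rewrite addrA lerD2l mulrCA -!mulrA ler_wpM2l // ler_wpM2l //.
  by rewrite ler_piMl // ltW.
have dk : dmax * k <= dmax by rewrite ler_piMr.
have errV := mulr_ge0 kV_ge0 err_ge0.
split; last exact: (superposition_distortion_bound hb errV D_ge0 dmax_ge0 (ltW kp)).
rewrite mulrC -ler_pdivrMl //.
exact: (superposition_error_bound hb dist_ge0 dk dmax_ge0 k_le1).
Qed.

End SuperpositionCode.

(** * Achievability *)

Section Achievability.
Variable R : realType.

Lemma limn_esup_le_cvg_ubound (u v : nat -> R) (l : R) :
  (forall n, u n <= v n) -> v n @[n --> \oo] --> l ->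
  (limn_esup (fun n => (u n)%:E) <= l%:E)%E.
Proof.
move=> uv vl; have vlE : (v n)%:E @[n --> \oo] --> l%:E.
  by apply: cvg_EFin => //; exact: nearW.
rewrite -(cvg_limn_einf_sup vlE).2 !limn_esup_lim.
apply: lee_lim; [exact: is_cvg_esups|exact: is_cvg_esups|].
apply: nearW => n; apply: ge_ereal_sup => _ [m /= nm <-].
apply: (@le_trans _ _ (v m)%:E); first by rewrite lee_fin.
by apply: ereal_sup_ubound; exists m.
Qed.

Variables (X S Y Z Shat : finType) (PS : S -> R) (W : X -> S -> Y * Z -> R).
Variable d : S -> Shat -> R.
Hypothesis PS_pmf : is_pmf PS.
Hypothesis W_pmf : forall x s, is_pmf (W x s).
Hypothesis d_ge0 : forall s s', 0 <= d s s'.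

Lemma error_prob_ge0 n M (c : isac_code X S Y Z Shat n M) :
  0 <= error_prob PS W c.
Proof.
rewrite error_probE mulr_ge0 // sumr_ge0 // => w _.
apply: channel_mean_ge0 => //; first exact: iid_is_pmf.
by move=> x s; exact: memoryless_is_pmf.
Qed.

Lemma achievable_geometric (r D kappa C : R) : 0 < kappa < 1 ->
  (forall n, exists c : isac_code X S Y Z Shat n (num_messages r n),
    error_prob PS W c <= C * kappa ^+ n /\
    distortion PS W d c <= D + C * kappa ^+ n) ->
  achievable PS W d r D.
Proof.
move=> /andP[k0 k1] h; exists (fun n => projT1 (cid (h n))).
have k_lt1 : `|kappa| < 1 by rewrite ger0_norm // ltW.
have geo : (C * kappa ^+ n) @[n --> \oo] --> (0 : R).
  exact: cvg_geometric.
split.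
  apply: (squeeze_cvgr _ (cvg_cst 0) geo); apply: nearW => n.
  by case: cid => c /= [ec _]; rewrite error_prob_ge0.
apply: (@limn_esup_le_cvg_ubound _ (fun n => D + C * kappa ^+ n)).
  by move=> n; case: cid => c /= [].
by rewrite -[X in _ --> X]addr0; apply: cvgD => //; exact: cvg_cst.
Qed.

(** Disintegration of P_UX. Where the marginal vanishes the kernel is a point mass, so that it is a
    pmf for every [u]; the point [x0] exists because a pmf cannot live on an empty product. *)
Lemma kernel_exists (U : finType) (PUX : U * X -> R) : is_pmf PUX ->
  exists (PU : U -> R) (K : U -> X -> R),
  [/\ is_pmf PU, forall u, is_pmf (K u) &
      PUX = (fun ux => PU ux.1 * K ux.1 ux.2)].
Proof.
move=> [P0 P1].
have [x0 _] : exists x : X, True.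
  have : \sum_t PUX t != 0 by rewrite P1 oner_neq0.
  apply: contra_neqP => /forallNP h; apply: big1 => -[u x] _.
  by case: (h x).
pose PU u := \sum_x PUX (u, x).
have PU0 u : 0 <= PU u by exact: sumr_ge0.
exists PU, (fun u x => if PU u == 0 then (x == x0)%:R else PUX (u, x) / PU u).
split.
- by split=> //; rewrite -P1 pair_bigA; apply: eq_bigr => -[].
- move=> u; case: eqP => [_|/eqP h]; split=> [x|].
  + by [].
  + by rewrite -[RHS](sum_pointr x0 (fun=> 1)); apply: eq_bigr => x _; rewrite mul1r.
  + by rewrite divr_ge0.
  + by rewrite -mulr_suml divff.
- apply/funext => -[u x] /=; case: eqP => [h|/eqP h]; last by rewrite mulrC divfK.
  rewrite h mul0r; apply/eqP; rewrite eq_le P0 andbT -h.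
  by rewrite /PU (bigD1 x) //= lerDl sumr_ge0.
Qed.

Lemma achievable_superposition (U : finType) (PUX : U * X -> R)
    (shat : U -> Z -> Shat) (r D : R) :
  let p := single_letter_pmf PUX PS W in
  is_pmf PUX -> Expect p (fun o => d (rvS o) (shat (rvU o) (rvZ o))) <= D ->
  r < mutual_info p rvU rvZ +
      cond_mutual_info p rvX rvY (fun o => (rvU o, rvS o)) ->
  r < cond_mutual_info p rvX rvY rvS ->
  achievable PS W d r D.
Proof.
move=> p /kernel_exists[PU [K [PU_pmf K_pmf E]]]; rewrite /p E => hD h1 h2.
have [kappa [C [k01 hC]]] :=
  superposition_codes PU_pmf K_pmf PS_pmf W_pmf d_ge0 hD h1 h2.
exact: achievable_geometric k01 hC.
Qed.

(* A nonpositive rate means a single message, as does the rate 0. *)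
Lemma achievable_zero_rate (r D : R) : r <= 0 ->
  achievable PS W d r D -> achievable PS W d 0 D.
Proof.
move=> r0; suff E : num_messages r = num_messages (0 : R) by rewrite /achievable E.
have one (x : R) : x <= 0 -> forall n, num_messages x n = 1%N.
  move=> x0 n; apply/eqP; rewrite eqn_leq num_messages_gt0 andbT.
  rewrite -(ler_nat R) num_messagesE -[1%:R]/(1%:~R) ler_int ceil_le_int.
  rewrite -[leRHS](powRr0 2); apply: ler_powR; first by rewrite ler1n.
  by rewrite mulr_ge0_le0.
by apply/funext => n; rewrite !one.
Qed.

(** Every rate strictly below the minimum [m] is achievable, and the supremum closes the gap. Since
    capacity only counts nonnegative rates, for [m <= 0] the rate [m - 1] is traded for rate 0, and
    otherwise [m - e] is truncated at 0. *)
Lemma min_rate_le_capacity (U : finType) (PUX : U * X -> R)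
    (shat : U -> Z -> Shat) (D : R) :
  let p := single_letter_pmf PUX PS W in
  is_pmf PUX -> Expect p (fun o => d (rvS o) (shat (rvU o) (rvZ o))) <= D ->
  ((Num.min (mutual_info p rvU rvZ +
             cond_mutual_info p rvX rvY (fun o => (rvU o, rvS o)))
            (cond_mutual_info p rvX rvY rvS))%:E <=
   capacity_distortion PS W d D)%E.
Proof.
move=> p PUX_pmf hD; set m := Num.min _ _.
have ach r : r < m -> achievable PS W d r D.
  by rewrite lt_min => /andP[]; exact: (achievable_superposition PUX_pmf hD).
case: (leP m 0) => m0.
  apply: (@le_trans _ _ 0%:E); first by rewrite lee_fin.
  apply: ereal_sup_ubound; exists 0 => //; split=> //.
  by apply: (@achievable_zero_rate (m - 1)); [lra | apply: ach; lra].
apply/lee_subgt0Pr => e e0; rewrite -EFinB.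
apply: (@le_trans _ _ (Num.max 0 (m - e))%:E).
  by rewrite lee_fin le_max lexx orbT.
apply: ereal_sup_ubound; exists (Num.max 0 (m - e)) => //; split.
  by rewrite le_max lexx.
by apply: ach; rewrite gt_max m0 /=; lra.
Qed.

End Achievability.

(** * Existence of the maximum *)

Section Entropy.
Variable R : realType.

Definition xlnx (t : R) : R := t * ln t.

(** On the negative side the default value of [ln] makes the function 0. At 0 it is squeezed between
    [- (2 * Num.sqrt t)] and 0: with [s] the root of [t], [t * ln t] is [2 * s * (s * ln s)], and
    [- ln s <= s^-1] puts [s * ln s] between -1 and 0. *)
Lemma xlnx_continuous : continuous xlnx.
Proof.
move=> x; case: (ltgtP x 0) => [x0|x0|->].
- suff h : \near x, xlnx x = 0.
    by apply: (@near_cst_continuous _ _ 0).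
  near=> t; rewrite /xlnx ln0 ?mulr0 // ltW //; near: t.
  exact: lt_nbhsl.
- by apply: cvgM; [exact: cvg_id | exact: continuous_ln].
have sqrt0 : (- (2 * Num.sqrt t)) @[t --> (0 : R)] --> (0 : R).
  have h : Num.sqrt t @[t --> (0 : R)] --> (0 : R).
    by have := @sqrt_continuous R 0; rewrite /continuous_at sqrtr0.
  have : - (2 * Num.sqrt t) @[t --> (0 : R)] --> - (2 * 0 : R).
    by apply: cvgN; apply: cvgM => //; exact: cvg_cst.
  by rewrite mulr0 oppr0.
rewrite /continuous_at {2}/xlnx mul0r.
apply: (squeeze_cvgr _ sqrt0 (cvg_cst 0)).
near=> t; rewrite /xlnx.
have [t0|t0] := leP t 0; first by rewrite ln0 // ler0_sqrtr // !mulr0 oppr0 lexx.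
have t1 : t < 1 by near: t; exact: lt_nbhsl.
set s := Num.sqrt t; have s0 : 0 < s by rewrite sqrtr_gt0.
have ts : t = s ^+ 2 by rewrite sqr_sqrtr // ltW.
have l1 : ln s <= 0 by rewrite ln_le0 // -(sqrtr1 R) ler_wsqrtr // ltW.
have l2 : - ln s <= s^-1.
  rewrite -lnV ?posrE //; have := @le_ln1Dx R (s^-1 - 1).
  have : 0 < s^-1 by rewrite invr_gt0.
  by move=> s1 /(_ ltac:(lra)); rewrite addrC subrK; lra.
have -> : t * ln t = 2 * (s * (s * ln s)).
  have -> : ln t = 2 * ln s by rewrite ts lnXn // mulr_natl.
  by rewrite {1}ts expr2; ring.
have a0 : s * ln s <= 0 by rewrite pmulr_rle0.
have a1 : - 1 <= s * ln s.
  by rewrite -lerN2 opprK -mulrN -(@mulfV _ s) ?gt_eqF // ler_pM2l.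
have b0 : 0 <= s * (- (s * ln s)) by apply: mulr_ge0 (ltW s0) _; rewrite oppr_ge0.
have b1 : s * (- (s * ln s)) <= s * 1 by rewrite ler_pM2l //; lra.
move: b0 b1; rewrite mulrN mulr1; lra.
Unshelve. all: by end_near. Qed.

Variables (T : finType) (p : T -> R).

(** Minus the entropy, in nats. Information written with it is visibly continuous, also where
    probabilities vanish and the logarithms of ratios do not behave well. *)
Definition neg_entropy (V : finType) (f : T -> V) : R :=
  \sum_v xlnx (law p f v).

Hypothesis p_pmf : is_pmf p.

Lemma sum_law_comp (V V' : finType) (f : T -> V) (h : V -> V') (F : V' -> R) :
  \sum_v law p f v * F (h v) = \sum_w law p (fun t => h (f t)) w * F w.
Proof. by rewrite -!sum_law. Qed.

Lemma law_gt0 (V V' : finType) (f : T -> V) (h : V -> V') v :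
  law p f v != 0 -> 0 < law p (fun t => h (f t)) (h v).
Proof.
move=> v0; rewrite lt_neqAle law_ge0 // andbT eq_sym.
by apply: contra_neq v0 => /(law_eq0 p_pmf).
Qed.

(** Marginal entropies are spread over the joint law by [sum_law_comp]. Terms of joint probability 0
    vanish on both sides; in the others all marginals are positive and the logarithm splits. *)
Lemma mutual_info_entropy (T1 T2 : finType) (A : T -> T1) (B : T -> T2) :
  mutual_info p A B =
  (neg_entropy (fun t => (A t, B t)) - neg_entropy A - neg_entropy B) / ln 2.
Proof.
rewrite mutual_infoE.
have -> : neg_entropy A = \sum_v law p (fun t => (A t, B t)) v * ln (law p A v.1).
  by rewrite (sum_law_comp (fun t => (A t, B t)) fst (fun a => ln (law p A a))).
have -> : neg_entropy B = \sum_v law p (fun t => (A t, B t)) v * ln (law p B v.2).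
  by rewrite (sum_law_comp (fun t => (A t, B t)) snd (fun a => ln (law p B a))).
rewrite -!sumrB mulr_suml; apply: eq_bigr => v _; rewrite /xlnx /log2 -!mulrBr.
have [->|v0] := eqVneq (law p (fun t => (A t, B t)) v) 0; first by rewrite !mul0r.
have P0 := law_gt0 id v0; rewrite /= in P0.
have A0 := law_gt0 fst v0; rewrite /= in A0.
have B0 := law_gt0 snd v0; rewrite /= in B0.
rewrite -mulrA; congr (_ * (_ / _)).
by rewrite ln_div ?posrE ?mulr_gt0 // lnM ?posrE // opprD addrA.
Qed.

Lemma cond_mutual_info_entropy (T1 T2 T3 : finType) (A : T -> T1) (B : T -> T2)
    (C : T -> T3) :
  cond_mutual_info p A B C =
  (neg_entropy (fun t => (A t, B t, C t)) + neg_entropy C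
   - neg_entropy (fun t => (A t, C t)) - neg_entropy (fun t => (B t, C t)))
  / ln 2.
Proof.
pose f t := (A t, B t, C t).
have EC : neg_entropy C = \sum_v law p f v * ln (law p C v.2).
  by rewrite (sum_law_comp f snd (fun a => ln (law p C a))).
have EAC : neg_entropy (fun t => (A t, C t)) =
    \sum_v law p f v * ln (law p (fun t => (A t, C t)) (v.1.1, v.2)).
  by rewrite (sum_law_comp f (fun v => (v.1.1, v.2))
    (fun a => ln (law p (fun t => (A t, C t)) a))).
have EBC : neg_entropy (fun t => (B t, C t)) =
    \sum_v law p f v * ln (law p (fun t => (B t, C t)) (v.1.2, v.2)).
  by rewrite (sum_law_comp f (fun v => (v.1.2, v.2))
    (fun a => ln (law p (fun t => (B t, C t)) a))).
rewrite EC EAC EBC /cond_mutual_info pair_bigA /= pair_bigA /=.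
rewrite -big_split -!sumrB mulr_suml /=; apply: eq_bigr => -[[a b] c] _ /=.
rewrite /xlnx /log2 -mulrDr -!mulrBr -/f.
have [->|v0] := eqVneq (law p f (a, b, c)) 0; first by rewrite !mul0r.
have P0 := law_gt0 id v0; rewrite /= in P0.
have C0 := law_gt0 snd v0; rewrite /= in C0.
have AC0 := law_gt0 (fun v => (v.1.1, v.2)) v0; rewrite /= in AC0.
have BC0 := law_gt0 (fun v => (v.1.2, v.2)) v0; rewrite /= in BC0.
rewrite -[RHS]mulrA; congr (_ * _); congr (_ / _); rewrite /cond_law.
have -> : law p f (a, b, c) / law p C c /
    (law p (fun o => (A o, C o)) (a, c) / law p C c *
     (law p (fun o => (B o, C o)) (b, c) / law p C c)) =
    law p f (a, b, c) * law p C c /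
    (law p (fun o => (A o, C o)) (a, c) * law p (fun o => (B o, C o)) (b, c)).
  by field; rewrite !gt_eqF.
by rewrite ln_div ?posrE ?mulr_gt0 // !lnM ?posrE // opprD addrA.
Qed.

End Entropy.

Section FiniteUnionMax.
Variable R : realType.

Lemma finite_union_max (I : finType) (A : I -> set R) :
  (forall i, A i !=set0 -> exists2 m, A i m & ubound (A i) m) ->
  (exists i, A i !=set0) ->
  exists m, (exists i, A i m) /\ forall i, ubound (A i) m.
Proof.
move=> hA [i0 i0P].
have /choice[m mP] : forall i, exists m, A i !=set0 -> A i m /\ ubound (A i) m.
  move=> i; have [/hA[m]|h] := pselect (A i !=set0); first by exists m.
  by exists 0 => /h.
(* Empty sets carry the dummy maximum 0, so the largest maximum is sought among the nonempty
   ones. *)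
pose P i := `[< A i !=set0 >].
have Pi0 : P i0 by apply/asboolP.
case: (arg_maxP m Pi0) => i /asboolP iP imax.
exists (m i); split; first by exists i; apply mP.
move=> j r Ajr; have jP : A j !=set0 by exists r.
by apply: le_trans ((mP j jP).2 _ Ajr) (imax _ _); apply/asboolP.
Qed.

End FiniteUnionMax.

(** * Compactness and continuity for a fixed auxiliary alphabet and estimator *)

Section Maximum.
Variables (R : realType) (X S Y Z Shat : finType).
Variables (PS : S -> R) (W : X -> S -> Y * Z -> R) (d : S -> Shat -> R).
Hypothesis PS_pmf : is_pmf PS.
Hypothesis W_pmf : forall x s, is_pmf (W x s).

Lemma joint_is_pmf (U : finType) (PUX : U * X -> R) :
  is_pmf PUX -> is_pmf (single_letter_pmf PUX PS W).
Proof.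
move=> [P0 P1]; split=> [[[[u x] s] yz]|].
  have [PS0 _] := PS_pmf; have [W0 _] := W_pmf x s.
  by rewrite /= !mulr_ge0.
pose F (uxs : U * X * S) yz := PUX uxs.1 * PS uxs.2 * W uxs.1.2 uxs.2 yz.
rewrite (_ : \sum_t _ = \sum_uxs \sum_yz F uxs yz); last first.
  by rewrite pair_bigA; apply: eq_bigr => -[[[u x] s] yz].
rewrite (_ : \sum_uxs _ = \sum_(uxs : U * X * S) PUX uxs.1 * PS uxs.2); last first.
  apply: eq_bigr => uxs _; rewrite -mulr_sumr.
  by have [_ ->] := W_pmf uxs.1.2 uxs.2; rewrite mulr1.
rewrite -(pair_bigA _ (fun ux s => PUX ux * PS s)) /= -P1.
apply: eq_bigr => ux _; rewrite -mulr_sumr.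
by have [_ ->] := PS_pmf; rewrite mulr1.
Qed.

Definition rate_bound (U : finType) (PUX : U * X -> R) : R :=
  let p := single_letter_pmf PUX PS W in
  Num.min (mutual_info p rvU rvZ +
           cond_mutual_info p rvX rvY (fun o => (rvU o, rvS o)))
          (cond_mutual_info p rvX rvY rvS).

Definition mean_cost (U : finType) (PUX : U * X -> R) (shat : U -> Z -> Shat) :=
  Expect (single_letter_pmf PUX PS W)
    (fun o => d (rvS o) (shat (rvU o) (rvZ o))).

(** The estimator is held fixed and may be suboptimal: the cost is then continuous in P_UX, whereas
    the arg min estimator would change with P_UX. *)
Definition rates_with (D : R) (U : finType) (shat : U -> Z -> Shat) : set R :=
  [set r | exists PUX : U * X -> R,
    [/\ is_pmf PUX, mean_cost PUX shat <= D & r = rate_bound PUX]].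

Section Continuity.
Variables (U : finType) (T : topologicalType) (P : T -> U * X -> R).
Hypothesis P_continuous : forall ux, continuous (P ^~ ux).

Lemma finsum_continuous (I : finType) (Q : pred I) (F : I -> T -> R) :
  (forall i, continuous (F i)) -> continuous (fun v => \sum_(i | Q i) F i v).
Proof. by move=> h; apply: continuous_big => //; exact: add_continuous. Qed.

Let p v := single_letter_pmf (P v) PS W.

Let joint_continuous o : continuous (p ^~ o).
Proof.
case: o => -[[u x] s] yz v.
apply: (@cvgM _ _ (nbhs v)); last exact: cvg_cst.
by apply: (@cvgM _ _ (nbhs v)); [exact: P_continuous | exact: cvg_cst].
Qed.

Lemma neg_entropy_continuous (V : finType) (f : U * X * S * (Y * Z) -> V) :
  continuous (fun v => neg_entropy (p v) f).
Proof.
apply: finsum_continuous => a v.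
apply: (@continuous_comp _ _ _ (fun v => law (p v) f a) (@xlnx R)).
  by apply: finsum_continuous => o; exact: joint_continuous.
exact: xlnx_continuous.
Qed.

Lemma mean_cost_continuous shat : continuous (fun v => mean_cost (P v) shat).
Proof.
apply: finsum_continuous => o v.
apply: (@cvgM _ _ (nbhs v)); last exact: cvg_cst.
exact: joint_continuous.
Qed.

Let H (V : finType) (f : U * X * S * (Y * Z) -> V) v := neg_entropy (p v) f.

Let sensing_rate v :=
  (H (fun o => (rvU o, rvZ o)) v - H rvU v - H rvZ v) / ln 2 +
  (H (fun o => (rvX o, rvY o, (rvU o, rvS o))) v + H (fun o => (rvU o, rvS o)) v
   - H (fun o => (rvX o, (rvU o, rvS o))) v
   - H (fun o => (rvY o, (rvU o, rvS o))) v) / ln 2.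

Let communication_rate v :=
  (H (fun o => (rvX o, rvY o, rvS o)) v + H rvS v
   - H (fun o => (rvX o, rvS o)) v - H (fun o => (rvY o, rvS o)) v) / ln 2.

(** This expression is continuous on the whole parameter space, including parameters that do not
    give a pmf; on pmfs it is the objective. *)
Definition entropy_rate v := Num.min (sensing_rate v) (communication_rate v).

Lemma entropy_rate_continuous : continuous entropy_rate.
Proof.
move=> v; apply: (@continuous_min R T sensing_rate communication_rate v).
  apply: (@cvgD _ _ _ (nbhs v)); apply: (@cvgM _ _ (nbhs v)); try exact: cvg_cst.
    apply: (@cvgB _ _ _ (nbhs v)); [apply: (@cvgB _ _ _ (nbhs v))|];
      exact: neg_entropy_continuous.
  apply: (@cvgB _ _ _ (nbhs v)); [apply: (@cvgB _ _ _ (nbhs v));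
    [apply: (@cvgD _ _ _ (nbhs v))|]|]; exact: neg_entropy_continuous.
apply: (@cvgM _ _ (nbhs v)); last exact: cvg_cst.
apply: (@cvgB _ _ _ (nbhs v)); [apply: (@cvgB _ _ _ (nbhs v));
  [apply: (@cvgD _ _ _ (nbhs v))|]|]; exact: neg_entropy_continuous.
Qed.

Lemma entropy_rateE v : is_pmf (P v) -> entropy_rate v = rate_bound (P v).
Proof.
move=> /joint_is_pmf p_pmf.
by rewrite /rate_bound /entropy_rate mutual_info_entropy // !cond_mutual_info_entropy.
Qed.

End Continuity.

Lemma rates_with_max (U : finType) (D : R) (shat : U -> Z -> Shat) :
  rates_with D shat !=set0 ->
  exists2 m, rates_with D shat m & ubound (rates_with D shat) m.
Proof.
set N := #|{: U * X}|.
(* Joint pmfs are coded as row vectors, where the feasible set is the unit cube cut by two closed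
   conditions, hence compact, and the extreme value theorem applies. *)
pose input (v : 'rV[R]_N) (ux : U * X) : R := v ord0 (enum_rank ux).
have input_continuous ux : continuous (input ^~ ux) by exact: coord_continuous.
pose feasible : set 'rV[R]_N := [set v | is_pmf (input v) /\
  mean_cost (input v) shat <= D].
have row (PUX : U * X -> R) : exists v : 'rV[R]_N, input v = PUX.
  exists (\row_i PUX (enum_val i)); apply/funext => ux.
  by rewrite /input mxE enum_rankK.
have feasible_compact : compact feasible.
  have -> : feasible = [set v : 'rV[R]_N | forall i, `[0, 1]%classic (v ord0 i)]
      `&` ((fun v => \sum_ux input v ux) @^-1` [set 1])
      `&` ((fun v => mean_cost (input v) shat) @^-1` [set y | y <= D]).
    apply/seteqP; split=> [v [[v0 v1] vD]|v [[v01 v1] vD]].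
      split=> //; split=> // i /=; rewrite in_itv /=.
      have := v0 (enum_val i); rewrite /input enum_valK => -> /=.
      rewrite -v1 (bigD1 (enum_val i)) //= /input enum_valK lerDl.
      by apply: sumr_ge0 => ux _; exact: v0.
    split=> //; split=> // ux; have := v01 (enum_rank ux).
    by rewrite /= in_itv /= => /andP[].
  apply: compact_closedI; first apply: compact_closedI.
  - apply: (@rV_compact R N (fun=> `[0, 1]%classic)) => i.
    exact: segment_compact.
  - apply: preimage_closed; last exact: closed_eq.
    by move=> v _; exact: finsum_continuous.
  - apply: preimage_closed; last exact: closed_le.
    by move=> v _; exact: mean_cost_continuous.
move=> [r [PUX [P_pmf PD rE]]].
have feasible0 : feasible !=set0.
  by have [v vE] := row PUX; exists v; rewrite /feasible /= vE.
have [v /set_mem[v_pmf vD] vmax] := EVT_max_rV feasible0 feasible_compact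
  (continuous_subspaceT (entropy_rate_continuous input_continuous)).
exists (entropy_rate input v); first by exists (input v); rewrite entropy_rateE.
move=> _ [P' [P'_pmf P'D ->]]; have [v' v'E] := row P'.
rewrite -v'E -entropy_rateE ?v'E //; apply: vmax; apply/mem_set.
by rewrite /feasible /= v'E.
Qed.

End Maximum.

(** * Invariance under relabelling of the auxiliary alphabet *)

Section Relabelling.
Variable R : realType.

(** Both entropies are written as means, over the sample space, of the logarithm of the probability
    of the observed value. Only attained values then occur, so injectivity of [k] suffices. *)
Lemma neg_entropy_relabel (T T' V V' : finType) (p : T -> R) (p' : T' -> R)
    (phi : T -> T') (k : V -> V') (f : T -> V) (f' : T' -> V') :
  bijective phi -> (forall t, p' (phi t) = p t) ->
  injective k -> (forall t, f' (phi t) = k (f t)) ->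
  neg_entropy p' f' = neg_entropy p f.
Proof.
move=> phi_bij pE k_inj fE.
have lawK v : law p' f' (k v) = law p f v.
  rewrite !lawE (reindex phi) /=; last exact: onW_bij.
  by apply: eq_bigr => t _; rewrite pE fE (inj_eq k_inj).
rewrite /neg_entropy /xlnx -(sum_law p' f' (fun v => ln (law p' f' v))).
rewrite -(sum_law p f (fun v => ln (law p f v))) (reindex phi) /=; last exact: onW_bij.
by apply: eq_bigr => t _; rewrite pE fE lawK.
Qed.

Variables (X S Y Z Shat : finType).
Variables (PS : S -> R) (W : X -> S -> Y * Z -> R) (d : S -> Shat -> R).
Hypothesis PS_pmf : is_pmf PS.
Hypothesis W_pmf : forall x s, is_pmf (W x s).

(** Auxiliary alphabets range over all finite types; this brings them to the ordinals, so that
    finitely many cases remain. *)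
Lemma rates_with_relabel (U U' : finType) (h : U -> U') (g : U' -> U) (D r : R)
    (shat : U -> Z -> Shat) :
  cancel h g -> cancel g h ->
  rates_with PS W d D shat r ->
  rates_with PS W d D (fun u z => shat (g u) z) r.
Proof.
move=> hK gK [PUX [[P0 P1] PD ->]].
have h_inj := can_inj hK.
pose PUX' (ux : U' * X) := PUX (g ux.1, ux.2).
have P'_pmf : is_pmf PUX'.
  split=> [ux|]; first exact: P0.
  rewrite -P1 (reindex (fun ux : U * X => (h ux.1, ux.2))) /=.
    by apply: eq_bigr => -[u x] _; rewrite /PUX' /= hK.
  by exists (fun ux => (g ux.1, ux.2)) => -[u x] _ /=; rewrite ?hK ?gK.
pose phi (o : U * X * S * (Y * Z)) : U' * X * S * (Y * Z) :=
  (h o.1.1.1, o.1.1.2, o.1.2, o.2).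
have phi_bij : bijective phi.
  exists (fun o : U' * X * S * (Y * Z) => (g o.1.1.1, o.1.1.2, o.1.2, o.2)).
    by move=> [[[u x] s] yz]; rewrite /phi /= hK.
  by move=> [[[u x] s] yz]; rewrite /phi /= gK.
have pE o : single_letter_pmf PUX' PS W (phi o) = single_letter_pmf PUX PS W o.
  by case: o => -[[u x] s] yz; rewrite /PUX' /= hK.
exists PUX'; split => //.
  apply: le_trans PD; rewrite /mean_cost /Expect (reindex phi) /=; last exact: onW_bij.
  rewrite le_eqVlt; apply/orP; left; apply/eqP; apply: eq_bigr => o _.
  by case: o => -[[u x] s] yz; rewrite /PUX' /phi /rvU /= hK.
have p_pmf : is_pmf (single_letter_pmf PUX PS W) by exact: joint_is_pmf.
have p'_pmf : is_pmf (single_letter_pmf PUX' PS W) by exact: joint_is_pmf.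
rewrite /rate_bound !mutual_info_entropy // !cond_mutual_info_entropy //.
pose E V V' k f f' := @neg_entropy_relabel _ _ V V' _ _ phi k f f' phi_bij pE.
symmetry; congr Num.min.
- congr (_ / _ + _ / _).
  + congr (_ - _ - _).
    * by apply: (E _ _ (fun v => (h v.1, v.2))) => // -[u z] [u' z'] [/h_inj -> ->].
    * exact: (E _ _ h).
    * exact: (E _ _ id).
  + congr (_ + _ - _ - _).
    * apply: (E _ _ (fun v => (v.1, (h v.2.1, v.2.2)))) => //.
      by move=> [xy [u s]] [xy' [u' s']] [-> /h_inj -> ->].
    * by apply: (E _ _ (fun v => (h v.1, v.2))) => // -[u z] [u' z'] [/h_inj -> ->].
    * apply: (E _ _ (fun v => (v.1, (h v.2.1, v.2.2)))) => //.
      by move=> [xy [u s]] [xy' [u' s']] [-> /h_inj -> ->].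
    * apply: (E _ _ (fun v => (v.1, (h v.2.1, v.2.2)))) => //.
      by move=> [xy [u s]] [xy' [u' s']] [-> /h_inj -> ->].
- by congr ((_ + _ - _ - _) / _); exact: (E _ _ id).
Qed.

End Relabelling.

(** * Optimality of the posterior arg min estimator *)

Section OptimalEstimator.
Variables (R : realType) (U X S Y Z Shat : finType).
Variables (p : U * X * S * (Y * Z) -> R) (d : S -> Shat -> R).

Lemma optimal_estimator_exists : (0 < #|Shat|)%N ->
  exists shat, optimal_estimator p d shat.
Proof.
move=> /card_gt0P[s0 _].
pose cost u z s' := \sum_s cond_law p rvS (fun o => (rvU o, rvZ o)) s (u, z) * d s s'.
exists (fun u z => [arg min_(s' < s0) cost u z s']%O) => u z s'.
by case: (arg_minP (cost u z) (isT : xpredT s0)) => s1 _ /(_ s' isT).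
Qed.

(** The mean distortion is the average over (u, z) of the posterior cost, which the estimator
    minimizes pointwise. Pairs of probability 0 have weight 0, so the default posterior there is
    harmless. *)
Lemma optimal_estimator_le (shat shat' : U -> Z -> Shat) :
  is_pmf p -> optimal_estimator p d shat ->
  Expect p (fun o => d (rvS o) (shat (rvU o) (rvZ o))) <=
  Expect p (fun o => d (rvS o) (shat' (rvU o) (rvZ o))).
Proof.
move=> p_pmf opt; pose UZ (o : U * X * S * (Y * Z)) := (rvU o, rvZ o).
have E (h : U -> Z -> Shat) : Expect p (fun o => d (rvS o) (h (rvU o) (rvZ o))) =
    \sum_uz law p UZ uz * \sum_s cond_law p rvS UZ s uz * d s (h uz.1 uz.2).
  rewrite (Expect_law p (fun o => (rvS o, UZ o))
    (fun v => d v.1 (h v.2.1 v.2.2))).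
  rewrite -(pair_bigA _ (fun s uz => law p (fun o => (rvS o, UZ o)) (s, uz) *
    d s (h uz.1 uz.2))) /= exchange_big; apply: eq_bigr => uz _ /=.
  rewrite mulr_sumr; apply: eq_bigr => s _; rewrite mulrA; congr (_ * _).
  rewrite /cond_law mulrC; have [h0|h0] := eqVneq (law p UZ uz) 0.
    by rewrite h0 mulr0; exact: (law_eq0 p_pmf (h := snd)).
  by rewrite divfK.
rewrite !E; apply: ler_sum => -[u z] _; apply: ler_wpM2l.
  exact: law_ge0.
exact: opt.
Qed.

End OptimalEstimator.

(** * The maximum over the feasible set *)

Section FeasibleRates.
Variables (R : realType) (X S Y Z Shat : finType).
Variables (PS : S -> R) (W : X -> S -> Y * Z -> R) (d : S -> Shat -> R).
Hypothesis Shat_gt0 : (0 < #|Shat|)%N.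
Hypothesis PS_pmf : is_pmf PS.
Hypothesis W_pmf : forall x s, is_pmf (W x s).

(** The rate does not depend on the estimator, and replacing an estimator by an optimal one can only
    lower the cost. *)
Lemma feasible_ratesP (D r : R) : feasible_rates PS W d D r <->
  exists (U : finType) (shat : U -> Z -> Shat),
    (#|U| <= #|X| + 1)%N /\ rates_with PS W d D shat r.
Proof.
split=> [[U [PUX [shat [cU P_pmf opt PD rE]]]]|[U [shat [cU [PUX [P_pmf PD rE]]]]]].
  by exists U, shat; split=> //; exists PUX.
have [shat' opt] :=
  optimal_estimator_exists (single_letter_pmf PUX PS W) d Shat_gt0.
exists U, PUX, shat'; split=> //; apply: le_trans PD.
exact: optimal_estimator_le (joint_is_pmf PS_pmf W_pmf P_pmf) opt.
Qed.

Let cost x (shat : Z -> Shat) :=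
  channel_mean PS W x (fun s yz => d s (shat yz.2)).

(** By linearity in P_X each mean cost is an average of costs at deterministic inputs, so the
    minimum over the finitely many pairs of an input and an estimator is a lower bound for all of
    them. *)
Lemma Dmin_vertex : (0 < #|X|)%N ->
  exists x shat, cost x shat <= Dmin PS W d.
Proof.
move=> /card_gt0P[x0 _]; have /card_gt0P[s0 _] := Shat_gt0.
pose F (v : X * {ffun Z -> Shat}) := cost v.1 v.2.
case: (arg_minP F (isT : xpredT (x0, [ffun=> s0]))) => -[x shat] _ Fmin.
have EE PX (h : Z -> Shat) :
    Expect (fun o : X * S * (Y * Z) => let: (x, s, yz) := o in PX x * PS s * W x s yz)
           (fun o => let: (x, s, (y, z)) := o in d s (h z)) =
    \sum_x PX x * cost x h.
  transitivity (\sum_x \sum_s \sum_yz PX x * PS s * W x s yz * d s (h yz.2)).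
    by rewrite pair_bigA /= pair_bigA /=; apply: eq_bigr => -[[? ?] [? ?]] _.
  apply: eq_bigr => x' _; rewrite !mulr_sumr; apply: eq_bigr => s _.
  by rewrite !mulr_sumr; apply: eq_bigr => yz _; ring.
exists x, shat; apply: lb_le_inf.
  eexists; exists (fun x' => (x' == x0)%:R), (fun=> s0); split; last by [].
  split=> //; rewrite -[RHS](sum_pointr x0 (fun=> 1)).
  by apply: eq_bigr => x' _; rewrite mul1r.
move=> _ [PX [h [[PX0 PX1] ->]]]; rewrite EE -[leLHS]mul1r -PX1 mulr_suml.
apply: ler_sum => x' _; apply: ler_wpM2l => //.
have := Fmin (x', [ffun z => h z]) isT; rewrite /F /= => /le_trans; apply.
rewrite le_eqVlt; apply/orP; left; apply/eqP; apply: eq_bigr => s _.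
by congr (_ * _); apply: eq_bigr => yz _; rewrite ffunE.
Qed.

Lemma rates_with_nonempty (D : R) : (0 < #|X|)%N -> Dmin PS W d <= D ->
  exists shat : 'I_1 -> Z -> Shat, rates_with PS W d D shat !=set0.
Proof.
move=> /Dmin_vertex[x [shat xD]] /(le_trans xD) {}xD.
exists (fun _ z => shat z).
(* The factor 1 is the law of the trivial auxiliary variable, written so as to match the product
   form in [joint_meanE]. *)
pose PUX := (fun ux : 'I_1 * X => 1 * (ux.2 == x)%:R) : _ -> R.
exists (rate_bound PS W PUX), PUX; split=> //.
  split=> [ux|]; first by rewrite /PUX mul1r.
  rewrite -(pair_bigA _ (fun u x => PUX (u, x))) big_ord1 /PUX /=.
  exact: (sum_pointr x (fun=> 1)).
rewrite /mean_cost /Expect /PUX.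
rewrite -(joint_meanE (fun _ : 'I_1 => 1) (fun _ x' => (x' == x)%:R) PS W
  (fun _ _ s yz => d s (shat yz.2))).
rewrite /joint_mean big_ord1 mul1r.
under eq_bigr => x' _ do rewrite mulrC.
by rewrite (sum_pointr x (fun x => cost x shat)).
Qed.

Lemma feasible_rates_max (D : R) : (0 < #|X|)%N -> Dmin PS W d <= D ->
  exists2 m, feasible_rates PS W d D m & ubound (feasible_rates PS W d D) m.
Proof.
move=> X_gt0 D_ge.
(* Finite index set of the union: [k] runs over the sizes 0 to [#|X| + 1], and estimators are
   uncurried into finite functions to form a finite type. *)
pose I := {k : 'I_(#|X| + 2) & {ffun 'I_k * Z -> Shat}}.
pose A (i : I) : set R :=
  rates_with PS W d D (fun u z => tagged i (u, z)).
have A_cover (U : finType) (shat : U -> Z -> Shat) r : (#|U| <= #|X| + 1)%N ->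
    rates_with PS W d D shat r -> exists i, A i r.
  rewrite -ltnS -addnS => cU rU.
  pose k : 'I_(#|X| + 2) := Ordinal cU.
  pose f : {ffun 'I_k * Z -> Shat} := [ffun v => shat (enum_val v.1) v.2].
  exists (Tagged (fun k : 'I_(#|X| + 2) => {ffun 'I_k * Z -> Shat}) f).
  have := rates_with_relabel PS_pmf W_pmf (@enum_rankK U) (@enum_valK U) rU.
  rewrite /A /=; congr (rates_with _ _ _ _ _ _).
  by apply/funext => u; apply/funext => z; rewrite ffunE.
have [||m [[i Aim] Amax]] := @finite_union_max R I A.
- by move=> i; exact: rates_with_max.
- have [shat [r hr]] := rates_with_nonempty X_gt0 D_ge.
  have [|i Ai] := A_cover _ shat r _ hr; first by rewrite card_ord addn1.
  by exists i, r.
exists m.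
  apply/feasible_ratesP; eexists; eexists; split; last exact: Aim.
  by rewrite card_ord -ltnS -addnS; exact: ltn_ord.
move=> r /feasible_ratesP[U [shat [cU rU]]].
by have [j Ajr] := A_cover U shat r cU rU; exact: Amax Ajr.
Qed.

End FeasibleRates.

Theorem theorem3 (R : realType) (X S Y Z Shat : finType)
  (X_gt0 : (0 < #|X|)%N) (Shat_gt0 : (0 < #|Shat|)%N)
  (PS : S -> R) (W : X -> S -> Y * Z -> R) (d : S -> Shat -> R)
  (PS_pmf : is_pmf PS) (W_pmf : forall x s, is_pmf (W x s))
  (d_ge0 : forall s s', 0 <= d s s')
  (D : R) (D_ge : Dmin PS W d <= D) :
  exists m : R,
    [/\ feasible_rates PS W d D m,
        ubound (feasible_rates PS W d D) m
      & (m%:E <= capacity_distortion PS W d D)%E].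
Proof.
have [m m_feasible m_max] :=
  feasible_rates_max Shat_gt0 PS_pmf W_pmf X_gt0 D_ge.
exists m; split=> //.
have [U [PUX [shat [_ P_pmf _ PD ->]]]] := m_feasible.
exact: min_rate_le_capacity P_pmf PD.
Qed.
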